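(* Let $G\subset\mathbb{C}^2$ be a pseudoconvex semitube domain. Then there is a sequence $(G_n)_{n\ge1}$ of semitube domains in $\mathbb{C}^2$, each $G_n$ being strongly pseudoconvex with $\mathcal{C}^\infty$-smooth boundary, such that $G_n\subset G_{n+1}\subset G$ for all $n$ and $\bigcup_n G_n=G$.
   Context: Identify $\mathbb{R}^3$ with $\mathbb{C}\times\mathbb{R}$. For a domain $B\subset\mathbb{R}^3$, the semitube domain with base $B$ is $S_B:=\{(z_1,z_2)\in\mathbb{C}^2:(z_1,\operatorname{Re} z_2)\in B\}$. A domain $G\subset\mathbb{C}^2$ is called a semitube domain if $G=S_B$ for some domain $B\subset\mathbb{R}^3$, i.e. $G$ is invariant under translations in the $\operatorname{Im} z_2$ direction. *)

(* Defs.v *)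
From Stdlib Require Import Reals Lra.
From Coquelicot Require Import Coquelicot.
Open Scope R_scope.

(* C^2, identified with R^4 via (z1, z2) = ((x1, y1), (x2, y2)). *)
Definition E := (C * C)%type.

Definition eadd (p q : E) : E := (Cplus (fst p) (fst q), Cplus (snd p) (snd q)).
Definition cmul (l : C) (p : E) : E := (Cmult l (fst p), Cmult l (snd p)).
Definition escal (t : R) (p : E) : E := cmul (RtoC t) p.
Definition esub (p q : E) : E := eadd p (escal (-1) q).
Definition enorm (p : E) : R := sqrt (Cmod (fst p) ^ 2 + Cmod (snd p) ^ 2).

Definition eopen (D : E -> Prop) : Prop := open D.
Definition connected_set (G : E -> Prop) : Prop :=
  forall A B : E -> Prop, open A -> open B ->
    (forall z, G z -> A z \/ B z) ->
    (forall z, G z -> A z -> B z -> False) ->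
    (exists z, G z /\ A z) -> (exists z, G z /\ B z) -> False.
Definition domain (G : E -> Prop) : Prop :=
  eopen G /\ (exists z, G z) /\ connected_set G.

(* Semitube domain: a domain invariant under translations in Im z2,
   i.e. G = S_B with B = {(z1, Re z2) : (z1,z2) in G}. *)
Definition semitube (G : E -> Prop) : Prop :=
  domain G /\
  forall (z1 : C) (x y y' : R), G (z1, (x, y)) <-> G (z1, (x, y')).

Definition basis (i : nat) : E :=
  match i with
  | O => ((1, 0), (0, 0))
  | 1%nat => ((0, 1), (0, 0))
  | 2%nat => ((0, 0), (1, 0))
  | _ => ((0, 0), (0, 1))
  end.

Definition pd (i : nat) (f : E -> R) (p : E) : R :=
  Derive (fun t => f (eadd p (escal t (basis i)))) 0.

Fixpoint Ck (k : nat) (U : E -> Prop) (f : E -> R) : Prop :=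
  (forall p, U p -> continuous f p) /\
  match k with
  | O => True
  | S k' =>
      (forall i p, (i < 4)%nat -> U p ->
         ex_derive (fun t => f (eadd p (escal t (basis i)))) 0) /\
      (forall i, (i < 4)%nat -> Ck k' U (pd i f))
  end.

Definition smooth_on (U : E -> Prop) (f : E -> R) : Prop := forall k, Ck k U f.

(* complex derivatives: d/dz_j = 1/2 (d/dx_j - i d/dy_j), j in {0,1} *)
Definition dz (j : nat) (f : E -> R) (p : E) : C :=
  (pd (2 * j) f p / 2, - pd (2 * j + 1) f p / 2).

(* d^2 f / dz_j dzbar_k
   = 1/4 (f_{x_j x_k} + f_{y_j y_k} + i (f_{x_j y_k} - f_{y_j x_k})) *)
Definition dzdzb (j k : nat) (f : E -> R) (p : E) : C :=
  ((pd (2 * j) (pd (2 * k) f) p + pd (2 * j + 1) (pd (2 * k + 1) f) p) / 4,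
   (pd (2 * j) (pd (2 * k + 1) f) p - pd (2 * j + 1) (pd (2 * k) f) p) / 4).

Definition wcomp (j : nat) (w : E) : C := match j with O => fst w | _ => snd w end.

Definition levi (f : E -> R) (p w : E) : C :=
  Cplus (Cplus (Cmult (Cmult (dzdzb 0 0 f p) (wcomp 0 w)) (Cconj (wcomp 0 w)))
               (Cmult (Cmult (dzdzb 0 1 f p) (wcomp 0 w)) (Cconj (wcomp 1 w))))
        (Cplus (Cmult (Cmult (dzdzb 1 0 f p) (wcomp 1 w)) (Cconj (wcomp 0 w)))
               (Cmult (Cmult (dzdzb 1 1 f p) (wcomp 1 w)) (Cconj (wcomp 1 w)))).

Definition complex_tangent (f : E -> R) (p w : E) : Prop :=
  Cplus (Cmult (dz 0 f p) (wcomp 0 w)) (Cmult (dz 1 f p) (wcomp 1 w)) = RtoC 0.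

Definition gradient_nonzero (f : E -> R) (p : E) : Prop :=
  exists i, (i < 4)%nat /\ pd i f p <> 0.

Definition bdry (G : E -> Prop) (p : E) : Prop :=
  ~ G p /\ forall eps, 0 < eps -> exists z, G z /\ enorm (esub z p) < eps.

Definition strongly_pseudoconvex_smooth (G : E -> Prop) : Prop :=
  forall p, bdry G p ->
    exists (U : E -> Prop) (rho : E -> R),
      open U /\ U p /\ smooth_on U rho /\
      (forall z, U z -> (G z <-> rho z < 0)) /\
      (forall q, U q -> bdry G q ->
         gradient_nonzero rho q /\
         forall w, w <> ((0, 0), (0, 0)) -> complex_tangent rho q w ->
           0 < Re (levi rho q w)).

Definition psh_cont (G : E -> Prop) (u : E -> R) : Prop :=
  (forall z, G z -> continuous u z) /\
  forall a b : E,
    (forall l : C, Cmod l <= 1 -> G (eadd a (cmul l b))) ->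
    u a <= / (2 * PI) *
           RInt (fun th => u (eadd a (cmul (cos th, sin th) b))) 0 (2 * PI).

Definition bdist (G : E -> Prop) (z : E) : R :=
  real (Glb_Rbar (fun r => exists w, ~ G w /\ r = enorm (esub z w))).

Definition pseudoconvex (G : E -> Prop) : Prop :=
  domain G /\ ((forall z, G z) \/ psh_cont G (fun z => - ln (bdist G z))).

(* Main.v *)
Require Import Defs.
From Stdlib Require Import Reals Lra Lia FunctionalExtensionality Classical List.
From Stdlib Require Import IndefiniteDescription FinFun.
From Coquelicot Require Import Coquelicot.
Open Scope R_scope.

(** Let d be the boundary distance of G and phi = - ln d + x1^2 + y1^2 + x2^2.  For each n the
    truncation - ln (max d e^-(n+1)) is globally Lipschitz and agrees with - ln d where phi < n + 1.
    Convolving it with a bump in each of the four real coordinates gives a smooth function, close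
    to it, whose Levi form is nonnegative near {phi <= n + 3/4}: convolution preserves the sub-mean
    value inequality (Fubini), and the second-order Taylor expansion on small circles turns this
    inequality into nonnegativity of the Levi form.  Adding x1^2 + y1^2 + x2^2 makes the Levi form
    positive.  A small linear term a.(x1, y1, x2) and a level c close to n are then chosen so that c
    is a regular value.  Instead of Sard's theorem this uses that the bad pairs (a, c) form a
    Lipschitz image of a 3-dimensional cube in R^4.  The resulting sublevel sets H_n satisfy
    {phi < n} <= H_n <= {phi < n + 1}, hence are nested and exhaust G; G_n is the polygonal component
    of H_n containing a fixed point of G. *)

(** * Integrals of Lipschitz functions *)

(** The sublevel sets are unbounded in Im z2, so compactness exists only modulo translation. Hence
    [d], its truncation, the mollification, the quadratic and the linear term are all invariant
    under [sh 3], and estimates are made on the base, where quadratic growth beats the at most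
    linear decay of a Lipschitz function. This is why y2^2 is absent; the Levi form of x2^2 alone is
    positive in the z2 direction. The function - ln d makes no sense across the boundary of G.
    Truncating it gives a globally Lipschitz function that can be convolved on all of C^2. With
    Lipschitz data every derivative follows from an explicit quadratic remainder, and convolving one
    axis at a time needs only one-variable Riemann integrals. The unit gap between n and n + 1 is a
    budget: 1/8 for smoothing, 1/8 for the linear term, and a shift of the level by at least 1/4 so
    that both errors are absorbed. A sublevel set may be disconnected while a domain may not, hence
    the components: connectedness of G makes their union all of G, and the nonvanishing gradient
    makes a component agree with the sublevel set near its own boundary. *)

Definition lip1 (L : R) (f : R -> R) : Prop :=
  forall x y, Rabs (f x - f y) <= L * Rabs (x - y).

Lemma lip1_continuous L f : lip1 L f -> forall x, continuous f x.
Proof.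
  intros HL x. apply continuity_pt_filterlim.
  intros eps Heps.
  assert (HM : 0 < Rabs L + 1) by (pose proof (Rabs_pos L); lra).
  exists (eps / (Rabs L + 1)). split; [apply Rdiv_lt_0_compat; lra|].
  intros y [_ Hy]. simpl in *. unfold R_dist in *.
  eapply Rle_lt_trans; [apply HL|].
  apply Rle_lt_trans with ((Rabs L + 1) * Rabs (y - x)).
  - apply Rmult_le_compat_r; [apply Rabs_pos|]. pose proof (Rle_abs L). lra.
  - apply (Rmult_lt_compat_l (Rabs L + 1)) in Hy; [|lra].
    replace ((Rabs L + 1) * (eps / (Rabs L + 1))) with eps in Hy by (field; lra). lra.
Qed.

(** A quadratic remainder survives integration of the integrand's remainder, so this criterion
    stands in for the theorems on differentiation under the integral sign. *)
Lemma is_derive_quadratic (f : R -> R) (x l r C : R) :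
  0 < r ->
  (forall t, Rabs t <= r -> Rabs (f (x + t) - f x - t * l) <= C * t ^ 2) ->
  is_derive f x l.
Proof.
  intros Hr H. apply is_derive_Reals. intros eps Heps.
  assert (HM : 0 < Rabs C + 1) by (pose proof (Rabs_pos C); lra).
  assert (Hd : 0 < Rmin r (eps / (Rabs C + 1))).
  { apply Rmin_glb_lt; [lra|apply Rdiv_lt_0_compat; lra]. }
  exists (mkposreal _ Hd). intros h Hh Hhd. simpl in Hhd.
  assert (H1 : Rabs h <= r) by (eapply Rle_trans; [apply Rlt_le, Hhd|apply Rmin_l]).
  assert (H2 : Rabs h < eps / (Rabs C + 1)) by (eapply Rlt_le_trans; [apply Hhd|apply Rmin_r]).
  specialize (H h H1).
  assert (Hp : 0 < Rabs h) by now apply Rabs_pos_lt.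
  replace ((f (x + h) - f x) / h - l) with ((f (x + h) - f x - h * l) * / h) by (field; auto).
  rewrite Rabs_mult, Rabs_inv.
  apply (Rmult_lt_reg_r (Rabs h)); [lra|].
  rewrite Rmult_assoc, Rinv_l, Rmult_1_r by lra.
  eapply Rle_lt_trans; [apply H|].
  rewrite <- Rsqr_pow2, (Rsqr_abs h). unfold Rsqr.
  apply (Rmult_lt_compat_l (Rabs C + 1)) in H2; [|lra].
  replace ((Rabs C + 1) * (eps / (Rabs C + 1))) with eps in H2 by (field; lra).
  pose proof (Rle_abs C). nra.
Qed.

Lemma ex_RInt_cont (f : R -> R) a b : (forall x, continuous f x) -> ex_RInt f a b.
Proof. intros H. apply (ex_RInt_continuous (V := R_CompleteNormedModule)). auto. Qed.

Lemma RInt_minus_cont (f g : R -> R) a b :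
  (forall x, continuous f x) -> (forall x, continuous g x) ->
  RInt (fun x => f x - g x) a b = RInt f a b - RInt g a b.
Proof.
  intros Hf Hg.
  apply (RInt_minus (V := R_CompleteNormedModule) f g); now apply ex_RInt_cont.
Qed.

Lemma RInt_scal_cont (f : R -> R) l a b :
  (forall x, continuous f x) -> RInt (fun x => l * f x) a b = l * RInt f a b.
Proof.
  intros Hf. apply (RInt_scal (V := R_CompleteNormedModule) f a b l); now apply ex_RInt_cont.
Qed.

Lemma continuous_Rminus (f g : R -> R) x :
  continuous f x -> continuous g x -> continuous (fun y => f y - g y) x.
Proof. intros Hf Hg. apply (continuous_minus (V := R_NormedModule) f g); auto. Qed.

Lemma continuous_Rmult (f g : R -> R) x :
  continuous f x -> continuous g x -> continuous (fun y => f y * g y) x.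
Proof. intros Hf Hg. apply (continuous_mult (K := R_AbsRing) f g); auto. Qed.

Lemma RInt_const_R (c a b : R) : RInt (fun _ => c) a b = (b - a) * c.
Proof. apply (RInt_const (V := R_CompleteNormedModule)). Qed.

Lemma RInt_abs_bound (f : R -> R) a b M :
  (forall x, continuous f x) ->
  (forall t, Rabs (f t) <= M) -> Rabs (RInt f a b) <= Rabs (b - a) * M.
Proof.
  intros Hf HM. destruct (Rle_dec a b) as [H|H].
  - rewrite (Rabs_pos_eq (b - a)) by lra.
    apply abs_RInt_le_const; auto. now apply ex_RInt_cont.
  - rewrite <- opp_RInt_swap by now apply ex_RInt_cont.
    unfold opp; simpl. rewrite Rabs_Ropp, <- Rabs_Ropp.
    rewrite Rabs_Ropp, Rabs_minus_sym, (Rabs_pos_eq (a - b)) by lra.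
    apply abs_RInt_le_const; auto; [lra|]. now apply ex_RInt_cont.
Qed.

Lemma RInt_Rminus_Chasles (f : R -> R) a b c :
  (forall x, continuous f x) -> RInt f a c - RInt f a b = RInt f b c.
Proof.
  intros Hf.
  pose proof (RInt_Chasles (V := R_CompleteNormedModule) f a b c (ex_RInt_cont f a b Hf)
    (ex_RInt_cont f b c Hf)) as H.
  unfold plus in H; simpl in H. lra.
Qed.

Lemma is_derive_const_eq (f : R -> R) a b :
  (forall x, is_derive f x 0) -> f a = f b.
Proof.
  intros H. destruct (MVT_gen f a b (fun _ => 0)) as [c [_ Hc]]; [auto| |lra].
  intros x _. apply continuity_pt_filterlim.
  apply (ex_derive_continuous (K := R_AbsRing) (V := R_NormedModule) f x). now exists 0.
Qed.

(* Fubini: both iterated integrals have the same derivative in the upper bound of [s]. *)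
Section Fubini.

Variables (F : R -> R -> R) (L : R).
Hypothesis HF : forall s s' t t', Rabs (F s t - F s' t') <= L * (Rabs (s - s') + Rabs (t - t')).

Lemma fub_Lpos : 0 <= L.
Proof.
  pose proof (HF 1 0 0 0) as H. pose proof (Rabs_pos (F 1 0 - F 0 0)).
  rewrite !Rminus_0_r, Rabs_R1, Rabs_R0 in H. lra.
Qed.

Lemma fub_cont1 t : forall s, continuous (fun s => F s t) s.
Proof.
  apply (lip1_continuous L). intros x y. eapply Rle_trans; [apply HF|].
  rewrite Rminus_diag, Rabs_R0. lra.
Qed.

Lemma fub_cont2 s : forall t, continuous (fun t => F s t) t.
Proof.
  apply (lip1_continuous L). intros x y. eapply Rle_trans; [apply HF|].
  rewrite Rminus_diag, Rabs_R0. lra.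
Qed.

Lemma fub_int1_lip a b : lip1 (Rabs (b - a) * L) (fun t => RInt (fun s => F s t) a b).
Proof.
  intros x y. rewrite <- RInt_minus_cont by apply fub_cont1.
  rewrite Rmult_assoc. apply RInt_abs_bound.
  - intros s. apply continuous_Rminus; apply fub_cont1.
  - intros s. eapply Rle_trans; [apply HF|]. rewrite Rminus_diag, Rabs_R0. lra.
Qed.

Lemma fub_int2_lip a b : lip1 (Rabs (b - a) * L) (fun s => RInt (fun t => F s t) a b).
Proof.
  intros x y. rewrite <- RInt_minus_cont by apply fub_cont2.
  rewrite Rmult_assoc. apply RInt_abs_bound.
  - intros s. apply continuous_Rminus; apply fub_cont2.
  - intros s. eapply Rle_trans; [apply HF|]. rewrite Rminus_diag, Rabs_R0. lra.
Qed.

Lemma RInt_swap_order a b c d : a <= b -> c <= d ->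
  RInt (fun s => RInt (fun t => F s t) c d) a b = RInt (fun t => RInt (fun s => F s t) a b) c d.
Proof.
  intros Hab Hcd.
  set (I := fun s => RInt (fun t => F s t) c d).
  assert (CI : forall s, continuous I s) by (eapply lip1_continuous, fub_int2_lip).
  assert (CJ : forall x y s, continuous (fun t => RInt (fun s => F s t) x y) s)
    by (intros x y; eapply lip1_continuous, fub_int1_lip).
  set (Psi := fun x => RInt (fun t => RInt (fun s => F s t) a x) c d).
  assert (DPhi : forall x, is_derive (fun x => RInt I a x) x (I x)).
  { intros x. apply (is_derive_RInt (V := R_CompleteNormedModule) I _ a); [|apply CI].
    apply filter_forall. intros y. apply (RInt_correct (V := R_CompleteNormedModule)).
    now apply ex_RInt_cont. }
  (* The remainder of [Psi] at step [h] is the integral over [t] of the integral of [F s t - F x t]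
     for [s] between [x] and [x + h]; the inner one is at most [L * h ^ 2]. *)
  assert (DPsi : forall x, is_derive Psi x (I x)).
  { intros x. apply (is_derive_quadratic _ _ _ 1 (Rabs (d - c) * L)); [lra|].
    intros h _. unfold Psi, I.
    rewrite <- RInt_minus_cont by auto.
    rewrite <- RInt_scal_cont by apply fub_cont2.
    rewrite <- RInt_minus_cont; cycle 1.
    { intros t. apply continuous_Rminus; apply CJ. }
    { intros t. apply continuous_Rmult; [apply continuous_const|apply fub_cont2]. }
    rewrite Rmult_assoc. apply RInt_abs_bound.
    - intros t. apply continuous_Rminus; [apply continuous_Rminus; apply CJ|].
      apply continuous_Rmult; [apply continuous_const|apply fub_cont2].
    - intros t. rewrite RInt_Rminus_Chasles by apply fub_cont1.
      assert (Hc : h * F x t = RInt (fun _ => F x t) x (x + h))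
        by (rewrite RInt_const_R; ring).
      rewrite Hc.
      rewrite <- RInt_minus_cont; [|apply fub_cont1|intros; apply continuous_const].
      assert (Hb : forall s, Rmin x (x + h) <= s <= Rmax x (x + h) ->
          Rabs (F s t - F x t) <= L * Rabs h).
      { intros s Hs. eapply Rle_trans; [apply HF|]. rewrite Rminus_diag, Rabs_R0, Rplus_0_r.
        apply Rmult_le_compat_l; [apply fub_Lpos|].
        revert Hs. unfold Rmin, Rmax, Rabs.
        destruct (Rle_dec x (x + h)), (Rcase_abs h), (Rcase_abs (s - x)); lra. }
      assert (Cx : forall s, continuous (fun s => F s t - F x t) s).
      { intros s. apply continuous_Rminus; [apply fub_cont1|apply continuous_const]. }
      replace (L * h ^ 2) with (Rabs h * (L * Rabs h))
        by (rewrite <- Rsqr_pow2, (Rsqr_abs h); unfold Rsqr; ring).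
      destruct (Rle_dec 0 h) as [H|H].
      + rewrite (Rabs_pos_eq h) at 1 by lra.
        replace h with ((x + h) - x) at 2 by ring.
        apply abs_RInt_le_const; [lra|now apply ex_RInt_cont|].
        intros s Hs. apply Hb. rewrite Rmin_left, Rmax_right by lra. lra.
      + rewrite <- opp_RInt_swap by now apply ex_RInt_cont.
        unfold opp; simpl. rewrite Rabs_Ropp.
        rewrite (Rabs_left h) at 1 by lra.
        replace (- h) with (x - (x + h)) by ring.
        apply abs_RInt_le_const; [lra|now apply ex_RInt_cont|].
        intros s Hs. apply Hb. rewrite Rmin_right, Rmax_left by lra. lra. }
  assert (E1 : RInt I a b - Psi b = RInt I a a - Psi a).
  { symmetry.
    apply (is_derive_const_eq (fun x => RInt I a x - Psi x)). intros x.
    replace 0 with (I x - I x) by ring.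
    apply (is_derive_minus (K := R_AbsRing) (V := R_NormedModule)); auto. }
  rewrite RInt_point in E1. unfold zero in E1; simpl in E1.
  assert (E2 : Psi a = 0).
  { unfold Psi. rewrite (RInt_ext _ (fun _ => 0)); [rewrite RInt_const_R; apply Rmult_0_r|].
    intros t _. apply (RInt_point (V := R_CompleteNormedModule)). }
  unfold Psi in *. fold I. lra.
Qed.

End Fubini.

(** * Smooth compactly supported kernels *)

(** The derivative is existential, so closure under sums, products and affine substitution is an
    induction that exhibits a derivative and never computes [Derive_n]. *)
Fixpoint diffn (n : nat) (f : R -> R) : Prop :=
  match n with
  | O => True
  | S m => exists f', (forall x, is_derive f x (f' x)) /\ diffn m f'
  end.

Lemma diffn_pred n : forall f, diffn (S n) f -> diffn n f.
Proof.
  induction n as [|n IH]; intros f H; simpl; auto.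
  destruct H as [f' [Hd H]]. exists f'. split; auto.
Qed.

Lemma diffn_lincomb n : forall f g a b, diffn n f -> diffn n g ->
  diffn n (fun x => a * f x + b * g x).
Proof.
  induction n as [|n IH]; intros f g a b Hf Hg; simpl; auto.
  destruct Hf as [f' [Df Hf]], Hg as [g' [Dg Hg]].
  exists (fun x => a * f' x + b * g' x). split; [|now apply IH].
  intros x. apply (is_derive_plus (K := R_AbsRing) (V := R_NormedModule));
    apply is_derive_scal; auto.
Qed.

Lemma diffn_mult n : forall f g, diffn n f -> diffn n g -> diffn n (fun x => f x * g x).
Proof.
  induction n as [|n IH]; intros f g Hf Hg; simpl; auto.
  pose proof (diffn_pred _ _ Hf) as Hf0. pose proof (diffn_pred _ _ Hg) as Hg0.
  destruct Hf as [f' [Df Hf]], Hg as [g' [Dg Hg]].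
  exists (fun x => 1 * (f' x * g x) + 1 * (f x * g' x)). split.
  - intros x. rewrite !Rmult_1_l.
    apply (is_derive_mult (K := R_AbsRing) f g); auto. intros; apply Rmult_comm.
  - apply (diffn_lincomb n (fun x => f' x * g x) (fun x => f x * g' x)); now apply IH.
Qed.

Lemma diffn_affine n : forall f a b, diffn n f -> diffn n (fun x => f (a + b * x)).
Proof.
  induction n as [|n IH]; intros f a b Hf; simpl; auto.
  destruct Hf as [f' [Df Hf]].
  (* The zero summand only brings the derivative into the shape handled by [diffn_lincomb]. *)
  exists (fun x => b * f' (a + b * x) + 0 * f' (a + b * x)). split.
  - intros x. rewrite Rmult_0_l, Rplus_0_r.
    apply (is_derive_comp (K := R_AbsRing) (V := R_NormedModule) f (fun x => a + b * x)); auto.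
    auto_derive; auto; ring.
  - apply (diffn_lincomb n (fun x => f' (a + b * x)) (fun x => f' (a + b * x))); now apply IH.
Qed.

(** The classical exp(-1/x), flat at 0. The division by [x ^ m] closes the family under
    differentiation: the derivative of the member [m] combines the members [m + 2] and [m + 1]. *)
Definition flat (m : nat) (x : R) : R :=
  if Rlt_dec 0 x then exp (- / x) / x ^ m else 0.

Lemma flat_pos m x : 0 < x -> flat m x = exp (- / x) / x ^ m.
Proof. intros H. unfold flat. destruct (Rlt_dec 0 x); [reflexivity|lra]. Qed.

Lemma flat_neg m x : x <= 0 -> flat m x = 0.
Proof. intros H. unfold flat. destruct (Rlt_dec 0 x); [lra|reflexivity]. Qed.

(** [exp y] is the power [S n] of [exp (y / INR (S n))], which exceeds [y / INR (S n)]. *)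
Lemma pow_le_exp n y : 0 <= y -> y ^ S n <= INR (S n) ^ S n * exp y.
Proof.
  intros Hy.
  assert (Hn : 0 < INR (S n)) by (apply lt_0_INR; lia).
  replace y with (INR (S n) * (y / INR (S n))) at 1 by (field; lra).
  rewrite Rpow_mult_distr. apply Rmult_le_compat_l; [apply pow_le; lra|].
  replace y with (INR (S n) * (y / INR (S n))) at 2 by (field; lra).
  assert (H : forall k x, exp (INR k * x) = exp x ^ k).
  { induction k as [|k IH]; intros x; [simpl; rewrite Rmult_0_l; apply exp_0|].
    rewrite S_INR, Rmult_plus_distr_r, exp_plus, IH, Rmult_1_l. simpl. ring. }
  rewrite H. apply pow_incr.
  assert (0 <= y / INR (S n)) by (apply Rdiv_le_0_compat; lra).
  pose proof (exp_ineq1_le (y / INR (S n))). lra.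
Qed.

Lemma flat_ge_0 m x : 0 <= flat m x.
Proof.
  destruct (Rlt_dec 0 x) as [H|H]; [rewrite flat_pos by lra|rewrite flat_neg by lra; lra].
  apply Rdiv_le_0_compat; [left; apply exp_pos|now apply pow_lt].
Qed.

(** [pow_le_exp] at [/ x] with exponent [m + 2] leaves two spare powers of [x]; this yields the zero
    derivative at the origin, the only delicate point. *)
Lemma flat_quadratic m x : flat m x <= INR (S (S m)) ^ S (S m) * x ^ 2.
Proof.
  destruct (Rlt_dec 0 x) as [H|H].
  - rewrite flat_pos by lra.
    assert (Hi : 0 <= / x) by (left; now apply Rinv_0_lt_compat).
    pose proof (pow_le_exp (S m) (/ x) Hi) as Hp.
    assert (Hx : 0 < x ^ m) by now apply pow_lt.
    rewrite exp_Ropp. rewrite pow_inv in Hp.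
    set (c := INR (S (S m)) ^ S (S m)) in *.
    pose proof (exp_pos (/ x)) as He. set (e := exp (/ x)) in *.
    simpl in Hp |- *. rewrite Rmult_1_r.
    apply (Rmult_le_reg_r (e * x ^ m)); [nra|].
    replace (/ e / x ^ m * (e * x ^ m)) with 1 by (field; split; lra).
    assert (Hx2 : 0 < x * (x * x ^ m)) by (repeat apply Rmult_lt_0_compat; lra).
    apply (Rmult_le_compat_r (x * (x * x ^ m))) in Hp; [|lra].
    rewrite Rinv_l in Hp by lra. lra.
  - rewrite flat_neg by lra. apply Rmult_le_pos; [apply pow_le, pos_INR|apply pow2_ge_0].
Qed.

Lemma is_derive_flat m x :
  is_derive (flat m) x (1 * flat (S (S m)) x + (- INR m) * flat (S m) x).
Proof.
  destruct (Rtotal_order x 0) as [H|[H|H]].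
  - rewrite !flat_neg by lra. rewrite !Rmult_0_r, Rplus_0_r.
    apply (is_derive_ext_loc (K := R_AbsRing) (V := R_NormedModule) (fun _ => 0)).
    2: apply (is_derive_const (K := R_AbsRing) (V := R_NormedModule)).
    assert (Hx : 0 < - x) by lra.
    exists (mkposreal _ Hx). intros y Hy. unfold ball in Hy; simpl in Hy.
    unfold AbsRing_ball, abs, minus, plus, opp in Hy; simpl in Hy.
    apply Rabs_def2 in Hy. symmetry. apply flat_neg. lra.
  - subst x. rewrite !flat_neg by lra. rewrite !Rmult_0_r, Rplus_0_r.
    apply (is_derive_quadratic _ _ _ 1 (INR (S (S m)) ^ S (S m))); [lra|].
    intros t _. rewrite (flat_neg m 0) by lra.
    rewrite Rplus_0_l, Rmult_0_r, !Rminus_0_r, Rabs_pos_eq by apply flat_ge_0.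
    apply flat_quadratic.
  - apply (is_derive_ext_loc (K := R_AbsRing) (V := R_NormedModule)
      (fun x => exp (- / x) / x ^ m)).
    { exists (mkposreal _ H). intros y Hy. unfold ball in Hy; simpl in Hy.
      unfold AbsRing_ball, abs, minus, plus, opp in Hy; simpl in Hy.
      apply Rabs_def2 in Hy. symmetry. apply flat_pos. lra. }
    rewrite !flat_pos by lra.
    assert (Hx : x ^ m <> 0) by (apply pow_nonzero; lra).
    auto_derive; [repeat split; auto; lra|].
    destruct m as [|m]; simpl pred; simpl pow in *; [simpl; field; lra|].
    assert (Hm : x ^ m <> 0) by (apply pow_nonzero; lra).
    field. split; lra.
Qed.

Lemma diffn_flat n : forall m, diffn n (flat m).
Proof.
  induction n as [|n IH]; intros m; simpl; auto.
  eexists. split; [apply is_derive_flat|].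
  apply (diffn_lincomb n (flat (S (S m))) (flat (S m))); apply IH.
Qed.

Lemma diffn_Derive_n f : (forall n, diffn n f) ->
  forall j, (forall n, diffn n (Derive_n f j)) /\
    forall x, is_derive (Derive_n f j) x (Derive_n f (S j) x).
Proof.
  intros Hf.
  assert (H : forall g, (forall n, diffn n g) ->
    (forall n, diffn n (Derive g)) /\ forall x, is_derive g x (Derive g x)).
  { intros g Hg. split.
    - intros n. destruct (Hg (S n)) as [g' [Dg Hg']].
      replace (Derive g) with g'; auto.
      apply functional_extensionality. intros x. symmetry. now apply is_derive_unique.
    - intros x. apply Derive_correct. destruct (Hg 1%nat) as [g' [Dg _]]. now exists (g' x). }
  induction j as [|j [IH1 IH2]].
  - split; [exact Hf|]. exact (proj2 (H f Hf)).
  - destruct (H _ IH1) as [H1 H2]. split; [exact H1|]. exact (proj2 (H _ H1)).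
Qed.

(* [K j] is [(-1)^j] times the [j]-th derivative of a bump: with this sign, differentiating
   [p => RInt (fun s => K j s * u (p + s e_i))] along [e_i] replaces [K j] by [K (S j)]. *)
Definition kernels (eps : R) (K : nat -> R -> R) : Prop :=
  (forall j x, is_derive (K j) x (- K (S j) x)) /\
  (forall j s, eps <= Rabs s -> K j s = 0) /\
  (forall s, 0 <= K O s) /\
  RInt (K O) (-1) 1 = 1.

Lemma derive_zero_outside (f : R -> R) (a x l : R) :
  (forall y, a <= Rabs y -> f y = 0) -> 0 < a -> a <= Rabs x -> is_derive f x l -> l = 0.
Proof.
  intros Hf Ha Hx Hl. apply is_derive_Reals in Hl.
  destruct (Req_dec l 0) as [H|H]; auto. exfalso.
  destruct (Hl (Rabs l) (Rabs_pos_lt _ H)) as [[d Hd] Hd']. simpl in Hd'.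
  (* The increment points away from the origin: at [Rabs x = a] the function may be nonzero on the
     inner side, but the outer difference quotients vanish. *)
  set (h := if Rle_dec 0 x then d / 2 else - (d / 2)).
  assert (Hh : h <> 0 /\ Rabs h < d /\ a <= Rabs (x + h)).
  { unfold h. destruct (Rle_dec 0 x).
    - rewrite (Rabs_pos_eq x) in Hx by lra. rewrite !Rabs_pos_eq by lra. lra.
    - rewrite (Rabs_left x) in Hx by lra. rewrite Rabs_Ropp, Rabs_pos_eq by lra.
      rewrite Rabs_left by lra. lra. }
  destruct Hh as [H1 [H2 H3]]. specialize (Hd' h H1 H2).
  rewrite (Hf _ H3), (Hf _ Hx) in Hd'.
  replace ((0 - 0) / h - l) with (- l) in Hd' by (field; auto).
  rewrite Rabs_Ropp in Hd'. lra.
Qed.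

Lemma kernels_exist eps : 0 < eps < 1 -> exists K, kernels eps K.
Proof.
  intros He.
  (* A product of two flat functions facing each other, positive exactly on the open interval from
     [- eps] to [eps]. *)
  set (f := fun x => flat 0 (eps + 1 * x) * flat 0 (eps + (-1) * x)).
  assert (Hf : forall n, diffn n f).
  { intros n. apply diffn_mult; apply diffn_affine, diffn_flat. }
  assert (Hs : forall x, eps <= Rabs x -> f x = 0).
  { intros x Hx. unfold f, Rabs in *. destruct (Rcase_abs x).
    - rewrite (flat_neg 0 (eps + 1 * x)) by lra. ring.
    - rewrite (flat_neg 0 (eps + (-1) * x)) by lra. ring. }
  assert (Hp : forall x, 0 <= f x) by (intros; apply Rmult_le_pos; apply flat_ge_0).
  assert (Cf : forall x, continuous f x).
  { intros x. apply (ex_derive_continuous (K := R_AbsRing) (V := R_NormedModule)).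
    destruct (Hf 1%nat) as [f' [Df _]]. now exists (f' x). }
  assert (HI : 0 < RInt f (-1) 1).
  { assert (H1 := RInt_Rminus_Chasles f (-1) (-eps) 1 Cf).
    assert (H2 := RInt_Rminus_Chasles f (-eps) eps 1 Cf).
    assert (H3 : 0 <= RInt f (-1) (-eps)) by (apply RInt_ge_0; auto; [lra|now apply ex_RInt_cont]).
    assert (H4 : 0 <= RInt f eps 1) by (apply RInt_ge_0; auto; [lra|now apply ex_RInt_cont]).
    assert (H5 : 0 < RInt f (-eps) eps).
    { apply RInt_gt_0; [lra| |intros; apply Cf].
      intros x Hx. unfold f. rewrite !flat_pos by lra.
      apply Rmult_lt_0_compat; apply Rdiv_lt_0_compat; try apply exp_pos; simpl; lra. }
    simpl in *. lra. }
  set (I := RInt f (-1) 1) in *.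
  pose proof (diffn_Derive_n f Hf) as HD.
  (* Dividing by [I] normalises the mass to 1; the power of -1 gives the alternating sign that
     [kernels] asks for. *)
  exists (fun j x => ((-1) ^ j / I) * Derive_n f j x). split; [|split; [|split]].
  - intros j x.
    replace (- ((-1) ^ S j / I * Derive_n f (S j) x))
      with (((-1) ^ j / I) * Derive_n f (S j) x) by (simpl; field; lra).
    apply is_derive_scal. apply (proj2 (HD j)).
  - intros j s Hj. replace (Derive_n f j s) with 0; [ring|]. symmetry.
    revert s Hj. induction j as [|j IH]; intros s Hj; [now apply Hs|].
    apply (derive_zero_outside (Derive_n f j) eps s); auto; [lra|]. apply (proj2 (HD j)).
  - intros s. simpl. unfold Rdiv. rewrite Rmult_1_l.
    apply Rmult_le_pos; [left; now apply Rinv_0_lt_compat|apply Hp].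
  - simpl Derive_n. rewrite RInt_scal_cont by auto. fold I. simpl. field. lra.
Qed.

(** * Directional convolution *)

Definition co (i : nat) (p : E) : R :=
  match i with
  | O => fst (fst p)
  | 1%nat => snd (fst p)
  | 2%nat => fst (snd p)
  | _ => snd (snd p)
  end.

(** The l1 distance: a shift along one axis by [t] moves a point by exactly [Rabs t], and
    coordinatewise estimates simply add. It is comparable to [enorm] up to a factor 4. *)
Definition dist1 (p q : E) : R :=
  Rabs (co 0 p - co 0 q) + Rabs (co 1 p - co 1 q) +
  Rabs (co 2 p - co 2 q) + Rabs (co 3 p - co 3 q).

(** Unfolds to the very expression that is differentiated in [pd]. *)
Definition sh (i : nat) (t : R) (p : E) : E := eadd p (escal t (basis i)).

Lemma E_ext (p q : E) :
  co 0 p = co 0 q -> co 1 p = co 1 q -> co 2 p = co 2 q -> co 3 p = co 3 q -> p = q.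
Proof.
  destruct p as [[a b] [c d]], q as [[a' b'] [c' d']]; simpl. intros; subst; reflexivity.
Qed.

Lemma co_eadd i p q : co i (eadd p q) = co i p + co i q.
Proof. destruct i as [|[|[|i]]]; reflexivity. Qed.

Lemma co_escal i t p : co i (escal t p) = t * co i p.
Proof. destruct i as [|[|[|i]]]; simpl; ring. Qed.

Lemma co_sh j i t p : co j (sh i t p) = co j p + t * co j (basis i).
Proof. unfold sh. now rewrite co_eadd, co_escal. Qed.

Lemma sh_0 i p : sh i 0 p = p.
Proof. apply E_ext; rewrite co_sh; ring. Qed.

Lemma sh_sh i s t p : sh i s (sh i t p) = sh i (s + t) p.
Proof. apply E_ext; rewrite !co_sh; ring. Qed.

Lemma sh_comm i j s t p : sh i s (sh j t p) = sh j t (sh i s p).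
Proof. apply E_ext; rewrite !co_sh; ring. Qed.

Lemma sh_eadd i s p q : sh i s (eadd p q) = eadd (sh i s p) q.
Proof. apply E_ext; rewrite !co_sh, !co_eadd, !co_sh; ring. Qed.

Lemma dist1_pos p q : 0 <= dist1 p q.
Proof. unfold dist1. repeat apply Rplus_le_le_0_compat; apply Rabs_pos. Qed.

Lemma dist1_sym p q : dist1 p q = dist1 q p.
Proof.
  unfold dist1. rewrite (Rabs_minus_sym (co 0 p)), (Rabs_minus_sym (co 1 p)),
    (Rabs_minus_sym (co 2 p)), (Rabs_minus_sym (co 3 p)). reflexivity.
Qed.

Lemma dist1_refl p : dist1 p p = 0.
Proof. unfold dist1. rewrite !Rminus_diag, !Rabs_R0. ring. Qed.

Lemma dist1_tri p q r : dist1 p r <= dist1 p q + dist1 q r.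
Proof.
  assert (H : forall x y z, Rabs (x - z) <= Rabs (x - y) + Rabs (y - z)).
  { intros. replace (x - z) with ((x - y) + (y - z)) by ring. apply Rabs_triang. }
  unfold dist1.
  pose proof (H (co 0 p) (co 0 q) (co 0 r)). pose proof (H (co 1 p) (co 1 q) (co 1 r)).
  pose proof (H (co 2 p) (co 2 q) (co 2 r)). pose proof (H (co 3 p) (co 3 q) (co 3 r)). lra.
Qed.

Lemma dist1_translate p q p' q' :
  (forall j, co j p' - co j q' = co j p - co j q) -> dist1 p' q' = dist1 p q.
Proof. intros H. unfold dist1. now rewrite !H. Qed.

Lemma dist1_sh i t p q : dist1 (sh i t p) (sh i t q) = dist1 p q.
Proof. apply dist1_translate. intros j. rewrite !co_sh. ring. Qed.

Lemma dist1_sh_same i s t p : dist1 (sh i s p) (sh i t p) = Rabs (s - t).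
Proof.
  unfold dist1. rewrite !co_sh.
  replace (Rabs (s - t)) with (Rabs ((s - t) * 1)) by (f_equal; ring).
  destruct i as [|[|[|i]]]; simpl;
  match goal with |- Rabs ?a + Rabs ?b + Rabs ?c + Rabs ?d = _ =>
    ring_simplify a b c d end; rewrite ?Rabs_R0; ring_simplify ((s - t) * 1); lra.
Qed.

Lemma dist1_sh_l i s p : dist1 (sh i s p) p = Rabs s.
Proof.
  rewrite <- (sh_0 i p) at 2. rewrite dist1_sh_same. f_equal; ring.
Qed.

Definition Lip (L : R) (u : E -> R) : Prop :=
  0 <= L /\ forall p q, Rabs (u p - u q) <= L * dist1 p q.

Lemma Lip_sh_lip1 L u i p : Lip L u -> lip1 L (fun s => u (sh i s p)).
Proof. intros [_ H] s t. eapply Rle_trans; [apply H|]. rewrite dist1_sh_same. lra. Qed.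

Lemma Lip_sh_continuous L u i p : Lip L u -> forall s, continuous (fun s => u (sh i s p)) s.
Proof. intros H. eapply lip1_continuous, Lip_sh_lip1, H. Qed.

Lemma ball_dist1 (p q : E) (e : R) : dist1 p q < e -> ball p e q.
Proof.
  intros H. unfold dist1 in H.
  destruct p as [[a b] [c d]], q as [[a' b'] [c' d']]; simpl in H.
  rewrite (Rabs_minus_sym a), (Rabs_minus_sym b), (Rabs_minus_sym c), (Rabs_minus_sym d) in H.
  pose proof (Rabs_pos (a' - a)). pose proof (Rabs_pos (b' - b)).
  pose proof (Rabs_pos (c' - c)). pose proof (Rabs_pos (d' - d)).
  repeat split; unfold ball; simpl; unfold AbsRing_ball, abs, minus, plus, opp; simpl;
    unfold Rminus in *; lra.
Qed.

Lemma dist1_ball (p q : E) (e : R) : ball p e q -> dist1 p q < 4 * e.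
Proof.
  destruct p as [[a b] [c d]], q as [[a' b'] [c' d']].
  intros [[H1 H2] [H3 H4]]. unfold dist1; simpl in *.
  unfold ball in *; simpl in *; unfold AbsRing_ball, abs, minus, plus, opp in *; simpl in *.
  rewrite (Rabs_minus_sym a), (Rabs_minus_sym b), (Rabs_minus_sym c), (Rabs_minus_sym d).
  unfold Rminus. lra.
Qed.

Lemma open_dist1 (D : E -> Prop) :
  open D <-> forall p, D p -> exists e, 0 < e /\ forall q, dist1 p q < e -> D q.
Proof.
  split; intros H p Hp.
  - destruct (H p Hp) as [e He]. exists e. split; [apply cond_pos|].
    intros q Hq. apply He. now apply ball_dist1.
  - destruct (H p Hp) as [e [He HD]].
    assert (He4 : 0 < e / 4) by lra.
    exists (mkposreal _ He4). intros q Hq. apply HD.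
    apply dist1_ball in Hq. simpl in Hq. lra.
Qed.

Lemma continuous_dist1 (u : E -> R) (p : E) :
  continuous u p <->
  forall e, 0 < e -> exists d, 0 < d /\ forall q, dist1 p q < d -> Rabs (u q - u p) < e.
Proof.
  split.
  - intros H e He.
    destruct (H (fun y => Rabs (y - u p) < e)) as [d Hd].
    { exists (mkposreal _ He). intros y Hy. exact Hy. }
    exists d. split; [apply cond_pos|]. intros q Hq. apply Hd. now apply ball_dist1.
  - intros H P [e HP]. destruct (H e (cond_pos e)) as [d [Hd Hq]].
    assert (Hd4 : 0 < d / 4) by lra.
    exists (mkposreal _ Hd4). intros q Hb. apply HP.
    apply dist1_ball in Hb. simpl in Hb. apply Hq. lra.
Qed.

Lemma Lip_continuous L u p : Lip L u -> continuous u p.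
Proof.
  intros [H0 H]. apply continuous_dist1. intros e He.
  exists (e / (L + 1)). split; [apply Rdiv_lt_0_compat; lra|].
  intros q Hq. eapply Rle_lt_trans; [apply H|]. rewrite dist1_sym.
  pose proof (dist1_pos p q).
  apply (Rmult_lt_compat_l (L + 1)) in Hq; [|lra].
  replace ((L + 1) * (e / (L + 1))) with e in Hq by (field; lra). nra.
Qed.

Lemma is_derive_sh (v w : E -> R) i :
  (forall p, is_derive (fun t => v (sh i t p)) 0 (w p)) ->
  forall p x, is_derive (fun t => v (sh i t p)) x (w (sh i x p)).
Proof.
  intros Hd p x. apply (is_derive_ext (K := R_AbsRing) (V := R_NormedModule)
    (fun t => v (sh i (t - x) (sh i x p)))).
  - intros y. simpl. rewrite sh_sh. do 2 f_equal. ring.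
  - replace (w (sh i x p)) with (scal 1 (w (sh i x p))) by (apply Rmult_1_l).
    apply (is_derive_comp (K := R_AbsRing) (V := R_NormedModule)
      (fun t => v (sh i t (sh i x p))) (fun t => t - x)).
    + rewrite Rminus_diag. apply Hd.
    + auto_derive; auto.
Qed.

Lemma first_order_bound (v w : E -> R) L i :
  (forall p, is_derive (fun t => v (sh i t p)) 0 (w p)) -> Lip L w ->
  forall t p, Rabs (v (sh i t p) - v p - t * w p) <= L * t ^ 2.
Proof.
  intros Hd [HL0 HL] t p.
  pose proof (is_derive_sh v w i Hd p) as D.
  destruct (MVT_gen (fun t => v (sh i t p)) 0 t (fun x => w (sh i x p))) as [c [Hc Hm]].
  - intros; apply D.
  - intros x _. apply continuity_pt_filterlim.
    apply (ex_derive_continuous (K := R_AbsRing) (V := R_NormedModule)). eexists; apply D.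
  - simpl in Hm. rewrite sh_0, Rminus_0_r in Hm. rewrite Hm.
    replace (w (sh i c p) * t - t * w p) with (t * (w (sh i c p) - w p)) by ring.
    rewrite Rabs_mult.
    replace (L * t ^ 2) with (Rabs t * (L * Rabs t))
      by (rewrite <- Rsqr_pow2, (Rsqr_abs t); unfold Rsqr; ring).
    apply Rmult_le_compat_l; [apply Rabs_pos|].
    eapply Rle_trans; [apply HL|]. apply Rmult_le_compat_l; [exact HL0|].
    rewrite dist1_sh_l.
    revert Hc. unfold Rmin, Rmax, Rabs.
    destruct (Rle_dec 0 t), (Rcase_abs t), (Rcase_abs c); lra.
Qed.

(** Convolution along one axis, up to reflection of the kernel. The fixed interval is enough because
    the kernels used vanish once [Rabs s] reaches some [eps < 1]. *)
Definition T (i : nat) (k : R -> R) (u : E -> R) (p : E) : R :=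
  RInt (fun s => k s * u (sh i s p)) (-1) 1.

Lemma T_integrand_continuous i (k : R -> R) u L p :
  (forall x, continuous k x) -> Lip L u -> forall s, continuous (fun s => k s * u (sh i s p)) s.
Proof. intros Hk Hu s. apply continuous_Rmult; auto. eapply Lip_sh_continuous, Hu. Qed.

Lemma T_Lip i (k : R -> R) u B L :
  (forall x, continuous k x) -> (forall s, Rabs (k s) <= B) -> Lip L u ->
  Lip (2 * (B * L)) (T i k u).
Proof.
  intros Ck Hk Hu. pose proof (T_integrand_continuous i k u L) as HC. destruct Hu as [HL0 HL].
  assert (HB : 0 <= B) by (eapply Rle_trans; [apply Rabs_pos|apply (Hk 0)]).
  split; [nra|]. intros p q. unfold T.
  rewrite <- RInt_minus_cont by (intros; apply HC; auto; split; auto).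
  replace 2 with (Rabs (1 - -1)) by (rewrite Rabs_pos_eq; lra).
  rewrite Rmult_assoc. apply RInt_abs_bound.
  - intros s. apply continuous_Rminus; apply HC; auto; split; auto.
  - intros s. rewrite <- Rmult_minus_distr_l, Rabs_mult, Rmult_assoc.
    apply Rmult_le_compat; try apply Rabs_pos; auto.
    eapply Rle_trans; [apply HL|]. rewrite dist1_sh. lra.
Qed.

(** The first-order bound for [v] is uniform in the base point, so multiplying it by the bounded
    kernel and integrating leaves a quadratic remainder. *)
Lemma T_derive_under i m (k : R -> R) v w B L Lw :
  (forall x, continuous k x) -> (forall s, Rabs (k s) <= B) -> Lip L v -> Lip Lw w ->
  (forall p, is_derive (fun t => v (sh i t p)) 0 (w p)) ->
  forall p, is_derive (fun t => T m k v (sh i t p)) 0 (T m k w p).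
Proof.
  intros Ck Hk Hv Hw Hd p.
  assert (HB : 0 <= B) by (eapply Rle_trans; [apply Rabs_pos|apply (Hk 0)]).
  pose proof (T_integrand_continuous m k v L) as Cv.
  pose proof (T_integrand_continuous m k w Lw) as Cw.
  pose proof (first_order_bound v w Lw i Hd Hw) as HF.
  apply (is_derive_quadratic _ _ _ 1 (2 * (B * Lw))); [lra|].
  intros t _. rewrite Rplus_0_l, sh_0. unfold T.
  rewrite <- RInt_minus_cont by (intros; apply Cv; auto).
  rewrite <- RInt_scal_cont by (intros; apply Cw; auto).
  rewrite <- RInt_minus_cont; cycle 1.
  { intros s. apply continuous_Rminus; apply Cv; auto. }
  { intros s. apply continuous_Rmult; [apply continuous_const|]. apply Cw; auto. }
  apply (Rle_trans _ (Rabs (1 - -1) * (B * Lw * t ^ 2)));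
    [apply RInt_abs_bound|rewrite Rabs_pos_eq; lra].
  - intros s. apply continuous_Rminus; [apply continuous_Rminus; apply Cv; auto|].
    apply continuous_Rmult; [apply continuous_const|]. apply Cw; auto.
  - intros s. rewrite sh_comm.
    replace (k s * v (sh i t (sh m s p)) - k s * v (sh m s p) - t * (k s * w (sh m s p)))
      with (k s * (v (sh i t (sh m s p)) - v (sh m s p) - t * w (sh m s p))) by ring.
    rewrite Rabs_mult, Rmult_assoc.
    apply Rmult_le_compat; try apply Rabs_pos; auto.
Qed.

Lemma RInt_support (g : R -> R) a b a' b' :
  (forall x, continuous g x) -> a' <= a -> a <= b -> b <= b' ->
  (forall x, x <= a \/ b <= x -> g x = 0) -> RInt g a' b' = RInt g a b.
Proof.
  intros Cg H1 H2 H3 H0.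
  assert (Z : forall x y, x <= y -> (y <= a \/ b <= x) -> RInt g x y = 0).
  { intros x y Hxy Hz. rewrite (RInt_ext g (fun _ => 0)).
    - rewrite RInt_const_R. apply Rmult_0_r.
    - intros s Hs. rewrite Rmin_left, Rmax_right in Hs by lra. apply H0.
      destruct Hz; [left|right]; lra. }
  pose proof (RInt_Rminus_Chasles g a' a b' Cg) as E1.
  pose proof (RInt_Rminus_Chasles g a b b' Cg) as E2.
  rewrite (Z a' a) in E1 by lra. rewrite (Z b b') in E2 by lra. simpl in *. lra.
Qed.

Section Kernels.

Variables (eps : R) (K : nat -> R -> R).
Hypothesis Heps : 0 < eps < 1.
Hypothesis HK : kernels eps K.

Lemma K_derive j x : is_derive (K j) x (- K (S j) x).
Proof. apply HK. Qed.

Lemma K_supp j s : eps <= Rabs s -> K j s = 0.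
Proof. apply HK. Qed.

Lemma K_continuous j x : continuous (K j) x.
Proof.
  apply (ex_derive_continuous (K := R_AbsRing) (V := R_NormedModule)).
  eexists; apply K_derive.
Qed.

Lemma K_bounded j : exists B, 0 <= B /\ forall s, Rabs (K j s) <= B.
Proof.
  destruct (continuity_ab_maj (fun s => Rabs (K j s)) (-1) 1) as [M [HM _]]; [lra| |].
  - intros s _. apply continuity_pt_filterlim.
    apply (continuous_comp (K j) Rabs); [apply K_continuous|].
    apply continuity_pt_filterlim, Rcontinuity_abs.
  - exists (Rabs (K j M)). split; [apply Rabs_pos|]. intros s.
    destruct (Rle_dec eps (Rabs s)) as [H|H].
    + rewrite (K_supp j s H), Rabs_R0. apply Rabs_pos.
    + apply HM. apply Rnot_le_lt in H. apply Rabs_def2 in H. lra.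
Qed.

Lemma K_mvt j x y : exists c, Rmin x y <= c <= Rmax x y /\ K j y - K j x = - K (S j) c * (y - x).
Proof.
  apply (MVT_gen (K j) x y (fun c => - K (S j) c)).
  - intros; apply K_derive.
  - intros z _. apply continuity_pt_filterlim, K_continuous.
Qed.

Lemma K_lip j : exists B, 0 <= B /\ lip1 B (K j).
Proof.
  destruct (K_bounded (S j)) as [B [HB0 HB]]. exists B. split; auto. intros x y.
  destruct (K_mvt j y x) as [c [_ Hc]]. rewrite Hc, Rabs_mult, Rabs_Ropp.
  apply Rmult_le_compat_r; [apply Rabs_pos|auto].
Qed.

Lemma K_first_order j : exists B, 0 <= B /\
  forall s t, Rabs (K j (s - t) - K j s - t * K (S j) s) <= B * t ^ 2.
Proof.
  destruct (K_lip (S j)) as [B [HB0 HB]]. exists B. split; auto. intros s t.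
  destruct (K_mvt j s (s - t)) as [c [Hc Hm]]. rewrite Hm.
  replace (- K (S j) c * (s - t - s) - t * K (S j) s) with (t * (K (S j) c - K (S j) s)) by ring.
  rewrite Rabs_mult.
  replace (B * t ^ 2) with (Rabs t * (B * Rabs t))
    by (rewrite <- Rsqr_pow2, (Rsqr_abs t); unfold Rsqr; ring).
  apply Rmult_le_compat_l; [apply Rabs_pos|].
  eapply Rle_trans; [apply HB|]. apply Rmult_le_compat_l; [exact HB0|].
  revert Hc. unfold Rmin, Rmax, Rabs.
  destruct (Rle_dec s (s - t)), (Rcase_abs t), (Rcase_abs (c - s)); lra.
Qed.

(** Here [u] is merely Lipschitz. The substitution [s - t] moves the shift from [u] to the kernel,
    which is then expanded to first order. *)
Lemma T_derive_same i j u L p : Lip L u ->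
  is_derive (fun t => T i (K j) u (sh i t p)) 0 (T i (K (S j)) u p).
Proof.
  intros Hu.
  destruct (K_first_order j) as [B [HB0 HB]].
  assert (Cu : forall s, continuous (fun s => u (sh i s p)) s) by (eapply Lip_sh_continuous, Hu).
  assert (Ct : forall j t s, continuous (fun s => K j (s - t)) s).
  { intros j' t s. apply (continuous_comp (fun s => s - t) (K j')); [|apply K_continuous].
    apply continuous_Rminus; [apply continuous_id|apply continuous_const]. }
  assert (Cg : forall j t s, continuous (fun s => K j (s - t) * u (sh i s p)) s).
  { intros j' t s. apply continuous_Rmult; auto. }
  (* Both integrals must live on one interval to be subtracted; from -2 to 2 it contains the support
     of every kernel shifted by at most 1. *)
  assert (HT : forall j t, Rabs t <= 1 ->
    T i (K j) u (sh i t p) = RInt (fun s => K j (s - t) * u (sh i s p)) (-2) 2).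
  { intros j' t Ht. unfold T.
    rewrite (RInt_support _ (-1 + t) (1 + t) (-2) 2); auto.
    - pose proof (RInt_comp_lin (V := R_CompleteNormedModule)
        (fun s => K j' (s - t) * u (sh i s p)) 1 t (-1) 1) as H.
      rewrite !Rmult_1_l in H.
      replace (1 * -1 + t) with (-1 + t) in H by ring.
      rewrite <- H by now apply ex_RInt_cont.
      apply RInt_ext. intros s _. rewrite sh_sh. unfold scal; simpl. unfold mult; simpl.
      rewrite !Rmult_1_l. do 2 f_equal. ring.
    - apply Rabs_le_between in Ht. lra.
    - lra.
    - apply Rabs_le_between in Ht. lra.
    - intros x Hx. rewrite K_supp; [ring|].
      unfold Rabs. destruct (Rcase_abs (x - t)); lra. }
  assert (HT0 : forall j, T i (K j) u p = RInt (fun s => K j s * u (sh i s p)) (-2) 2).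
  { intros j'. rewrite <- (sh_0 i p) at 1. rewrite HT by (rewrite Rabs_R0; lra).
    apply RInt_ext. intros s _. now rewrite Rminus_0_r. }
  assert (Cg0 : forall j s, continuous (fun s => K j s * u (sh i s p)) s).
  { intros j' s. apply continuous_Rmult; auto. apply K_continuous. }
  apply (is_derive_quadratic _ _ _ 1 (4 * (B * (Rabs (u p) + L * 2)))); [lra|].
  intros t Ht. rewrite Rplus_0_l, sh_0, HT, !HT0 by auto.
  rewrite <- RInt_minus_cont by auto.
  rewrite <- RInt_scal_cont by auto.
  assert (C2 : forall s, continuous (fun s => K j (s - t) * u (sh i s p) - K j s * u (sh i s p)) s)
    by (intros; apply continuous_Rminus; auto).
  assert (C3 : forall s, continuous (fun s => t * (K (S j) s * u (sh i s p))) s)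
    by (intros; apply continuous_Rmult; auto; apply continuous_const).
  rewrite <- RInt_minus_cont by auto.
  replace 4 with (2 - -2) by ring. rewrite Rmult_assoc.
  apply abs_RInt_le_const; [lra| |].
  - apply ex_RInt_cont. intros s. apply continuous_Rminus; auto.
  - intros s Hs.
    replace (K j (s - t) * u (sh i s p) - K j s * u (sh i s p) - t * (K (S j) s * u (sh i s p)))
      with ((K j (s - t) - K j s - t * K (S j) s) * u (sh i s p)) by ring.
    rewrite Rabs_mult.
    replace (B * (Rabs (u p) + L * 2) * t ^ 2) with (B * t ^ 2 * (Rabs (u p) + L * 2)) by ring.
    apply Rmult_le_compat; try apply Rabs_pos; auto.
    destruct Hu as [HL0 HL].
    replace (u (sh i s p)) with (u p + (u (sh i s p) - u p)) by ring.
    eapply Rle_trans; [apply Rabs_triang|]. apply Rplus_le_compat_l.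
    eapply Rle_trans; [apply HL|]. apply Rmult_le_compat_l; [exact HL0|].
    rewrite dist1_sh_l. apply Rabs_le_between. lra.
Qed.

(* Successive convolution along the first [n] axes, with the [J m]-th kernel along axis [m]; so [J]
   is the multi-index of a derivative of the mollification of [u]. *)
Fixpoint V (u : E -> R) (n : nat) (J : nat -> nat) : E -> R :=
  match n with
  | O => u
  | S m => T m (K (J m)) (V u m J)
  end.

Definition incr (i : nat) (J : nat -> nat) (m : nat) : nat :=
  if Nat.eqb m i then S (J m) else J m.

Lemma V_Lip u L n J : Lip L u -> exists L', Lip L' (V u n J).
Proof.
  intros Hu. induction n as [|n [L' IH]]; [now exists L|].
  destruct (K_bounded (J n)) as [B [_ HB]]. eexists. simpl.
  eapply T_Lip; eauto. apply K_continuous.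
Qed.

Lemma V_ext u n J J' : (forall m, (m < n)%nat -> J m = J' m) -> V u n J = V u n J'.
Proof.
  induction n as [|n IH]; intros H; [reflexivity|].
  simpl. rewrite IH by (intros; apply H; lia). now rewrite (H n) by lia.
Qed.

(** Along the outermost axis the derivative falls on the kernel; along an inner axis it passes under
    the outer integral, where the induction hypothesis applies. *)
Lemma V_derive u L n : Lip L u -> forall i J p, (i < n)%nat ->
  is_derive (fun t => V u n J (sh i t p)) 0 (V u n (incr i J) p).
Proof.
  intros Hu. induction n as [|n IH]; intros i J p Hi; [lia|]. simpl.
  destruct (V_Lip u L n J Hu) as [L' HL'].
  destruct (Nat.eq_dec i n) as [->|Hn].
  - unfold incr at 1. rewrite Nat.eqb_refl.
    rewrite (V_ext u n (incr n J) J).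
    + eapply T_derive_same; eauto.
    + intros m Hm. unfold incr. destruct (Nat.eqb_spec m n); [lia|reflexivity].
  - unfold incr at 1. destruct (Nat.eqb_spec n i); [lia|].
    destruct (K_bounded (J n)) as [B [_ HB]].
    destruct (V_Lip u L n (incr i J) Hu) as [L'' HL''].
    eapply T_derive_under; eauto; [apply K_continuous|].
    intros q. apply IH. lia.
Qed.

End Kernels.

(** * Sub-mean value inequality and second-order expansion *)

Definition n1 (p : E) : R := Rabs (co 0 p) + Rabs (co 1 p) + Rabs (co 2 p) + Rabs (co 3 p).

Lemma n1_pos p : 0 <= n1 p.
Proof. unfold n1. repeat apply Rplus_le_le_0_compat; apply Rabs_pos. Qed.

Lemma n1_escal t p : n1 (escal t p) = Rabs t * n1 p.
Proof. unfold n1. rewrite !co_escal, !Rabs_mult. ring. Qed.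

Lemma dist1_eadd_l p W : dist1 (eadd p W) p = n1 W.
Proof.
  unfold dist1, n1. rewrite !co_eadd.
  replace (co 0 p + co 0 W - co 0 p) with (co 0 W) by ring.
  replace (co 1 p + co 1 W - co 1 p) with (co 1 W) by ring.
  replace (co 2 p + co 2 W - co 2 p) with (co 2 W) by ring.
  replace (co 3 p + co 3 W - co 3 p) with (co 3 W) by ring. reflexivity.
Qed.

Definition rot (th : R) (b : E) : E := cmul (cos th, sin th) b.
Definition circ (a b : E) (th : R) : E := eadd a (rot th b).

(** Multiplication by the imaginary unit in real coordinates, so that [circ a b th] is a + cos th b
    + sin th (i b). *)
Definition imul (w : E) : E := ((- co 1 w, co 0 w), (- co 3 w, co 2 w)).

Lemma co_rot j th b : co j (rot th b) = cos th * co j b + sin th * co j (imul b).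
Proof. destruct j as [|[|[|j]]]; simpl; ring. Qed.

Lemma n1_imul b : n1 (imul b) = n1 b.
Proof. unfold n1; simpl. rewrite !Rabs_Ropp. ring. Qed.

Lemma cos_sin_lip x y :
  Rabs (cos x - cos y) <= Rabs (x - y) /\ Rabs (sin x - sin y) <= Rabs (x - y).
Proof.
  split.
  - destruct (MVT_gen cos y x (fun z => - sin z)) as [c [_ Hc]].
    + intros; apply is_derive_cos.
    + intros z _. apply continuity_cos.
    + rewrite Hc, Rabs_mult, Rabs_Ropp. rewrite <- (Rmult_1_l (Rabs (x - y))) at 2.
      apply Rmult_le_compat_r; [apply Rabs_pos|]. apply Rabs_le, SIN_bound.
  - destruct (MVT_gen sin y x cos) as [c [_ Hc]].
    + intros; apply is_derive_sin.
    + intros z _. apply continuity_sin.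
    + rewrite Hc, Rabs_mult. rewrite <- (Rmult_1_l (Rabs (x - y))) at 2.
      apply Rmult_le_compat_r; [apply Rabs_pos|]. apply Rabs_le, COS_bound.
Qed.

Lemma lincomb_abs_le a b x y c : Rabs a <= c -> Rabs b <= c ->
  Rabs (a * x + b * y) <= c * (Rabs x + Rabs y).
Proof.
  intros Ha Hb. eapply Rle_trans; [apply Rabs_triang|]. rewrite !Rabs_mult.
  pose proof (Rabs_pos x). pose proof (Rabs_pos y). nra.
Qed.

Lemma n1_rot th b : n1 (rot th b) <= 2 * n1 b.
Proof.
  assert (H : forall j, Rabs (co j (rot th b)) <= 1 * (Rabs (co j b) + Rabs (co j (imul b)))).
  { intros j. rewrite co_rot. apply lincomb_abs_le; apply Rabs_le; [apply COS_bound|apply SIN_bound]. }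
  pose proof (n1_imul b) as Hi. unfold n1 in *.
  pose proof (H 0%nat). pose proof (H 1%nat). pose proof (H 2%nat). pose proof (H 3%nat). lra.
Qed.

Lemma circ_lip a b th th' : dist1 (circ a b th) (circ a b th') <= 2 * n1 b * Rabs (th - th').
Proof.
  assert (H : forall j, Rabs (co j (circ a b th) - co j (circ a b th')) <=
     Rabs (th - th') * (Rabs (co j b) + Rabs (co j (imul b)))).
  { intros j. unfold circ. rewrite !co_eadd, !co_rot.
    replace (co j a + (cos th * co j b + sin th * co j (imul b)) -
      (co j a + (cos th' * co j b + sin th' * co j (imul b)))) with
      ((cos th - cos th') * co j b + (sin th - sin th') * co j (imul b)) by ring.
    apply lincomb_abs_le; apply cos_sin_lip. }
  pose proof (n1_imul b) as Hi. unfold n1, dist1 in *.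
  pose proof (H 0%nat). pose proof (H 1%nat). pose proof (H 2%nat). pose proof (H 3%nat). nra.
Qed.

Lemma Lip_circ_continuous L v a b : Lip L v -> forall th, continuous (fun th => v (circ a b th)) th.
Proof.
  intros [HL0 HL]. apply (lip1_continuous (L * (2 * n1 b))). intros x y.
  eapply Rle_trans; [apply HL|]. rewrite Rmult_assoc. apply Rmult_le_compat_l; auto.
  apply circ_lip.
Qed.

(** Localised in centre and radius, because the truncation inherits the inequality only on discs
    along which [d] stays above the cut-off. *)
Definition submean (A : E -> Prop) (eta : R) (v : E -> R) : Prop :=
  forall a b, A a -> n1 b <= eta ->
    v a <= / (2 * PI) * RInt (fun th => v (circ a b th)) 0 (2 * PI).

(** Each translate by [s] satisfies the inequality; integrate against the nonnegative kernel and
    exchange the integral over [s] with the one over the circle. Only [Rabs s < eps] counts, which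
    is the shrinking from [A] to [A']. *)
Lemma T_submean i (k : R -> R) v (A A' : E -> Prop) eps eta B Lk L :
  0 < eps < 1 -> (forall s, eps <= Rabs s -> k s = 0) -> (forall s, 0 <= k s) ->
  (forall s, Rabs (k s) <= B) -> lip1 Lk k -> Lip L v ->
  (forall a s, A' a -> Rabs s < eps -> A (sh i s a)) ->
  submean A eta v -> submean A' eta (T i k v).
Proof.
  intros Heps Hsupp Hk0 HB HLk Hv HA Hsub a b Ha Hb.
  assert (Ck : forall x, continuous k x) by (eapply lip1_continuous, HLk).
  assert (HB0 : 0 <= B) by (eapply Rle_trans; [apply Rabs_pos|apply (HB 0)]).
  assert (HLk0 : 0 <= Lk).
  { pose proof (HLk 1 0) as H. pose proof (Rabs_pos (k 1 - k 0)).
    rewrite Rminus_0_r, Rabs_R1 in H. lra. }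
  set (F := fun s th => k s * v (sh i s (circ a b th))).
  set (M := Rabs (v a) + L * (1 + 2 * n1 b)).
  pose proof (n1_pos b) as Hn. pose proof (proj1 Hv) as HL0.
  assert (HM : forall s th, Rabs s < 1 -> Rabs (v (sh i s (circ a b th))) <= M).
  { intros s th Hs. unfold M.
    replace (v (sh i s (circ a b th))) with (v a + (v (sh i s (circ a b th)) - v a)) by ring.
    eapply Rle_trans; [apply Rabs_triang|]. apply Rplus_le_compat_l.
    eapply Rle_trans; [apply Hv|]. apply Rmult_le_compat_l; auto.
    eapply Rle_trans; [apply (dist1_tri _ (circ a b th))|]. rewrite dist1_sh_l.
    unfold circ. rewrite dist1_eadd_l. pose proof (n1_rot th b). lra. }
  assert (HM0 : 0 <= M).
  { eapply Rle_trans; [apply Rabs_pos|]. apply (HM 0 0). rewrite Rabs_R0; lra. }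
  set (LF := B * L * (1 + 2 * n1 b) + Lk * M).
  assert (HLF0 : 0 <= LF).
  { unfold LF. apply Rplus_le_le_0_compat; repeat apply Rmult_le_pos; lra. }
  (* Fubini wants a global Lipschitz bound although [v] may be unbounded. The product is split so
     that [v] itself is taken only at a parameter inside (-1, 1); if neither parameter lies there,
     both kernel values vanish. *)
  assert (HF1 : forall s s' t t', Rabs s < 1 ->
    Rabs (F s t - F s' t') <= LF * (Rabs (s - s') + Rabs (t - t'))).
  { intros s s' t t' Hs. unfold F.
    replace (k s * v (sh i s (circ a b t)) - k s' * v (sh i s' (circ a b t'))) with
      (k s' * (v (sh i s (circ a b t)) - v (sh i s' (circ a b t'))) +
       (k s - k s') * v (sh i s (circ a b t))) by ring.
    eapply Rle_trans; [apply Rabs_triang|]. rewrite !Rabs_mult.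
    assert (H1 : Rabs (v (sh i s (circ a b t)) - v (sh i s' (circ a b t'))) <=
      L * ((1 + 2 * n1 b) * (Rabs (s - s') + Rabs (t - t')))).
    { eapply Rle_trans; [apply Hv|]. apply Rmult_le_compat_l; auto.
      eapply Rle_trans; [apply (dist1_tri _ (sh i s' (circ a b t)))|].
      rewrite dist1_sh_same, dist1_sh. pose proof (circ_lip a b t t').
      pose proof (Rabs_pos (s - s')). pose proof (Rabs_pos (t - t')). nra. }
    assert (H2 : Rabs (k s - k s') * Rabs (v (sh i s (circ a b t))) <= Lk * Rabs (s - s') * M).
    { apply Rmult_le_compat; try apply Rabs_pos; [apply HLk|auto]. }
    assert (H3 : Rabs (k s') * Rabs (v (sh i s (circ a b t)) - v (sh i s' (circ a b t'))) <=
      B * (L * ((1 + 2 * n1 b) * (Rabs (s - s') + Rabs (t - t'))))).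
    { apply Rmult_le_compat; try apply Rabs_pos; auto. }
    assert (H4 : 0 <= Lk * M * Rabs (t - t')).
    { repeat apply Rmult_le_pos; auto; apply Rabs_pos. }
    unfold LF. lra. }
  assert (HF : forall s s' t t', Rabs (F s t - F s' t') <= LF * (Rabs (s - s') + Rabs (t - t'))).
  { intros s s' t t'.
    destruct (Rlt_dec (Rabs s) 1) as [H|H]; [now apply HF1|].
    destruct (Rlt_dec (Rabs s') 1) as [H'|H'].
    - rewrite Rabs_minus_sym, (Rabs_minus_sym s), (Rabs_minus_sym t). now apply HF1.
    - unfold F. rewrite (Hsupp s), (Hsupp s') by lra.
      rewrite !Rmult_0_l, Rminus_diag, Rabs_R0.
      apply Rmult_le_pos; auto. apply Rplus_le_le_0_compat; apply Rabs_pos. }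
  pose proof PI_RGT_0 as Hpi.
  unfold T at 2.
  change (T i k v a <= / (2 * PI) * RInt (fun t => RInt (fun s => F s t) (-1) 1) 0 (2 * PI)).
  rewrite <- (RInt_swap_order F LF HF (-1) 1 0 (2 * PI)) by lra.
  assert (CI : forall s, continuous (fun s => RInt (fun t => F s t) 0 (2 * PI)) s)
    by (eapply lip1_continuous, fub_int2_lip, HF).
  rewrite <- RInt_scal_cont by apply CI.
  unfold T. apply RInt_le; [lra| | |].
  - apply ex_RInt_cont. eapply T_integrand_continuous; eauto.
  - apply ex_RInt_cont. intros s. apply continuous_Rmult; [apply continuous_const|apply CI].
  - intros s Hs. unfold F.
    rewrite RInt_scal_cont.
    2: { intros th. apply (continuous_ext (fun th => v (circ (sh i s a) b th))).
      - intros x. unfold circ. now rewrite sh_eadd.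
      - eapply Lip_circ_continuous, Hv. }
    destruct (Rlt_dec (Rabs s) eps) as [H|H].
    + rewrite <- Rmult_assoc, (Rmult_comm _ (k s)), Rmult_assoc.
      apply Rmult_le_compat_l; auto.
      eapply Rle_trans; [apply (Hsub (sh i s a) b); auto|].
      right. f_equal. apply RInt_ext. intros th _. unfold circ. now rewrite sh_eadd.
    + rewrite Hsupp by lra. lra.
Qed.

(** [T i k v p] is a mean, with weights of total mass 1, of values [v (sh i s p)] with
    [Rabs s < eps]; each is within [c + L * eps] of [u p]. *)
Lemma T_close i (k : R -> R) u v eps L Lv c :
  0 < eps < 1 -> (forall x, continuous k x) ->
  (forall s, eps <= Rabs s -> k s = 0) -> (forall s, 0 <= k s) -> RInt k (-1) 1 = 1 ->
  Lip L u -> Lip Lv v -> (forall p, Rabs (v p - u p) <= c) ->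
  forall p, Rabs (T i k v p - u p) <= c + L * eps.
Proof.
  intros Heps Ck Hs Hk0 H1 Hu Hv Hc p.
  assert (Hb : forall s, Rabs s < eps -> Rabs (v (sh i s p) - u p) <= c + L * eps).
  { intros s Hse. replace (v (sh i s p) - u p) with
      ((v (sh i s p) - u (sh i s p)) + (u (sh i s p) - u p)) by ring.
    eapply Rle_trans; [apply Rabs_triang|]. apply Rplus_le_compat; auto.
    eapply Rle_trans; [apply Hu|]. apply Rmult_le_compat_l; [apply Hu|].
    rewrite dist1_sh_l. lra. }
  assert (Cc : forall m s, continuous (fun s => m * k s) s)
    by (intros; apply continuous_Rmult; auto; apply continuous_const).
  assert (Cv : forall s, continuous (fun s => k s * v (sh i s p)) s)
    by (eapply T_integrand_continuous; eauto).
  assert (Hm : forall m, RInt (fun s => m * k s) (-1) 1 = m).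
  { intros m. rewrite RInt_scal_cont by auto. rewrite H1. apply Rmult_1_r. }
  assert (Hlo : - (c + L * eps) + u p <= T i k v p).
  { unfold T. rewrite <- (Hm (- (c + L * eps) + u p)).
    apply RInt_le; [lra|now apply ex_RInt_cont|now apply ex_RInt_cont|].
    intros s _. destruct (Rlt_dec (Rabs s) eps) as [H|H].
    + rewrite Rmult_comm. apply Rmult_le_compat_l; auto.
      specialize (Hb s H). apply Rabs_le_between in Hb. lra.
    + rewrite Hs by lra. lra. }
  assert (Hhi : T i k v p <= c + L * eps + u p).
  { unfold T. rewrite <- (Hm (c + L * eps + u p)).
    apply RInt_le; [lra|now apply ex_RInt_cont|now apply ex_RInt_cont|].
    intros s _. destruct (Rlt_dec (Rabs s) eps) as [H|H].
    + rewrite (Rmult_comm _ (k s)). apply Rmult_le_compat_l; auto.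
      specialize (Hb s H). apply Rabs_le_between in Hb. lra.
    + rewrite Hs by lra. lra. }
  apply Rabs_le. lra.
Qed.

Definition sum4 (f : nat -> R) : R := f 0%nat + f 1%nat + f 2%nat + f 3%nat.

Lemma eadd_sh p W :
  eadd p W = sh 0 (co 0 W) (sh 1 (co 1 W) (sh 2 (co 2 W) (sh 3 (co 3 W) p))).
Proof. apply E_ext; rewrite !co_sh, co_eadd; simpl; ring. Qed.

Section ChainRule.

Variables (v : E -> R) (w : nat -> E -> R) (L : R).
Hypothesis Hd : forall i p, (i < 4)%nat -> is_derive (fun t => v (sh i t p)) 0 (w i p).
Hypothesis HL : forall i, (i < 4)%nat -> Lip L (w i).

(** Telescoping through four coordinate shifts. Replacing [w i] at the intermediate corner by its
    value at [p] costs [L * n1 W] times the shift. *)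
Lemma multi_first_order p W :
  Rabs (v (eadd p W) - v p - sum4 (fun i => co i W * w i p)) <= 2 * L * n1 W ^ 2.
Proof.
  assert (HL0 : 0 <= L) by (apply (HL 0%nat); lia).
  assert (step : forall i x, (i < 4)%nat -> dist1 x p <= n1 W ->
    Rabs (v (sh i (co i W) x) - v x - co i W * w i p) <= 2 * L * (Rabs (co i W) * n1 W)).
  { intros i x Hi Hx.
    assert (Hc : Rabs (co i W) <= n1 W).
    { unfold n1. pose proof (Rabs_pos (co 0 W)). pose proof (Rabs_pos (co 1 W)).
      pose proof (Rabs_pos (co 2 W)). pose proof (Rabs_pos (co 3 W)).
      destruct i as [|[|[|[|i]]]]; try lia; lra. }
    replace (v (sh i (co i W) x) - v x - co i W * w i p) with
      ((v (sh i (co i W) x) - v x - co i W * w i x) + co i W * (w i x - w i p)) by ring.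
    eapply Rle_trans; [apply Rabs_triang|]. rewrite Rabs_mult.
    assert (H1 := first_order_bound v (w i) L i (fun q => Hd i q Hi) (HL i Hi) (co i W) x).
    assert (H2 : Rabs (w i x - w i p) <= L * n1 W).
    { eapply Rle_trans; [apply (HL i Hi)|]. apply Rmult_le_compat_l; auto. }
    replace (co i W ^ 2) with (Rabs (co i W) * Rabs (co i W)) in H1
      by (rewrite <- Rsqr_pow2, (Rsqr_abs (co i W)); reflexivity).
    pose proof (Rabs_pos (co i W)) as Ha.
    assert (H3 : Rabs (co i W) * Rabs (w i x - w i p) <= Rabs (co i W) * (L * n1 W))
      by (apply Rmult_le_compat_l; auto).
    assert (H4 : L * (Rabs (co i W) * Rabs (co i W)) <= L * (Rabs (co i W) * n1 W))
      by (repeat apply Rmult_le_compat_l; auto).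
    lra. }
  rewrite eadd_sh.
  set (x3 := sh 3 (co 3 W) p). set (x2 := sh 2 (co 2 W) x3). set (x1 := sh 1 (co 1 W) x2).
  assert (D3 : dist1 x3 p <= Rabs (co 3 W)) by (right; apply dist1_sh_l).
  assert (D2 : dist1 x2 p <= Rabs (co 2 W) + Rabs (co 3 W)).
  { eapply Rle_trans; [apply (dist1_tri _ x3)|]. unfold x2. rewrite dist1_sh_l. lra. }
  assert (D1 : dist1 x1 p <= Rabs (co 1 W) + Rabs (co 2 W) + Rabs (co 3 W)).
  { eapply Rle_trans; [apply (dist1_tri _ x2)|]. unfold x1. rewrite dist1_sh_l. lra. }
  pose proof (Rabs_pos (co 0 W)). pose proof (Rabs_pos (co 1 W)).
  pose proof (Rabs_pos (co 2 W)). pose proof (Rabs_pos (co 3 W)).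
  assert (S3 := step 3%nat p ltac:(lia) ltac:(rewrite dist1_refl; apply n1_pos)).
  assert (S2 := step 2%nat x3 ltac:(lia) ltac:(unfold n1; lra)).
  assert (S1 := step 1%nat x2 ltac:(lia) ltac:(unfold n1; lra)).
  assert (S0 := step 0%nat x1 ltac:(lia) ltac:(unfold n1; lra)).
  fold x3 in S3. fold x2 in S2. fold x1 in S1.
  replace (2 * L * n1 W ^ 2) with
    (2 * L * (Rabs (co 0 W) * n1 W) + 2 * L * (Rabs (co 1 W) * n1 W) +
     (2 * L * (Rabs (co 2 W) * n1 W) + 2 * L * (Rabs (co 3 W) * n1 W))) by (unfold n1; ring).
  unfold sum4.
  replace (v (sh 0 (co 0 W) x1) - v p -
    (co 0 W * w 0%nat p + co 1 W * w 1%nat p + co 2 W * w 2%nat p + co 3 W * w 3%nat p)) with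
    ((v (sh 0 (co 0 W) x1) - v x1 - co 0 W * w 0%nat p) + (v x1 - v x2 - co 1 W * w 1%nat p) +
     ((v x2 - v x3 - co 2 W * w 2%nat p) + (v x3 - v p - co 3 W * w 3%nat p))) by ring.
  eapply Rle_trans; [apply Rabs_triang|].
  apply Rplus_le_compat; (eapply Rle_trans; [apply Rabs_triang|]);
    apply Rplus_le_compat; assumption.
Qed.

Lemma is_derive_direction p W t :
  is_derive (fun t => v (eadd p (escal t W))) t
    (sum4 (fun i => co i W * w i (eadd p (escal t W)))).
Proof.
  apply (is_derive_quadratic _ _ _ 1 (2 * L * n1 W ^ 2)); [lra|].
  intros h _. set (q := eadd p (escal t W)).
  replace (eadd p (escal (t + h) W)) with (eadd q (escal h W))
    by (apply E_ext; unfold q; rewrite !co_eadd, !co_escal; ring).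
  pose proof (multi_first_order q (escal h W)) as H.
  rewrite n1_escal in H. unfold sum4 in *. rewrite !co_escal in H.
  replace (h * (co 0 W * w 0%nat q + co 1 W * w 1%nat q + co 2 W * w 2%nat q + co 3 W * w 3%nat q))
    with (h * co 0 W * w 0%nat q + h * co 1 W * w 1%nat q + h * co 2 W * w 2%nat q +
          h * co 3 W * w 3%nat q) by ring.
  eapply Rle_trans; [apply H|]. right.
  rewrite Rpow_mult_distr, <- (Rsqr_pow2 (Rabs h)), <- Rsqr_abs, Rsqr_pow2. ring.
Qed.

End ChainRule.

(** Two uses of the mean value theorem, first for [g] minus its quadratic polynomial at 0, then for
    the derivative of that difference. *)
Lemma taylor1 (g g1 g2 : R -> R) M :
  (forall t, is_derive g t (g1 t)) -> (forall t, is_derive g1 t (g2 t)) ->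
  (forall t, 0 <= t <= 1 -> Rabs (g2 t - g2 0) <= M) ->
  Rabs (g 1 - g 0 - g1 0 - g2 0 / 2) <= M.
Proof.
  intros D1 D2 HM.
  assert (C : forall f f' : R -> R, (forall t, is_derive f t (f' t)) -> forall t, continuity_pt f t).
  { intros f f' Hf t. apply continuity_pt_filterlim.
    apply (ex_derive_continuous (K := R_AbsRing) (V := R_NormedModule)). eexists; apply Hf. }
  assert (DG1 : forall t, is_derive (fun t => g1 t - t * g2 0) t (g2 t - g2 0)).
  { intros t. apply (is_derive_minus (K := R_AbsRing) (V := R_NormedModule)); auto.
    auto_derive; auto; ring. }
  assert (DG : forall t, is_derive (fun t => g t - t * g1 0 - t ^ 2 / 2 * g2 0) t
      (g1 t - g1 0 - t * g2 0)).
  { intros t. apply (is_derive_minus (K := R_AbsRing) (V := R_NormedModule)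
      (fun t => g t - t * g1 0)).
    - apply (is_derive_minus (K := R_AbsRing) (V := R_NormedModule)); auto.
      auto_derive; auto; ring.
    - auto_derive; auto; field. }
  destruct (MVT_gen _ 0 1 _ (fun t _ => DG t) (fun t _ => C _ _ DG t)) as [c [Hc Ec]].
  rewrite Rmin_left, Rmax_right in Hc by lra. simpl in Ec.
  destruct (MVT_gen _ 0 c _ (fun t _ => DG1 t) (fun t _ => C _ _ DG1 t)) as [d [Hd Ed]].
  rewrite Rmin_left, Rmax_right in Hd by lra. simpl in Ed.
  replace (g 1 - g 0 - g1 0 - g2 0 / 2) with ((g2 d - g2 0) * c) by lra.
  rewrite Rabs_mult, (Rabs_pos_eq c) by lra.
  specialize (HM d ltac:(lra)). pose proof (Rabs_pos (g2 d - g2 0)). nra.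
Qed.

Definition quad (h : nat -> nat -> R) (W : E) : R :=
  sum4 (fun i => co i W * sum4 (fun j => co j W * h i j)).

Section Taylor2.

Variables (v : E -> R) (w : nat -> E -> R) (h : nat -> nat -> E -> R) (L1 L2 : R).
Hypothesis Hd1 : forall i p, (i < 4)%nat -> is_derive (fun t => v (sh i t p)) 0 (w i p).
Hypothesis HL1 : forall i, (i < 4)%nat -> Lip L1 (w i).
Hypothesis Hd2 : forall i j p, (i < 4)%nat -> (j < 4)%nat ->
  is_derive (fun t => w i (sh j t p)) 0 (h i j p).
Hypothesis HL2 : forall i j, (i < 4)%nat -> (j < 4)%nat -> Lip L2 (h i j).

Lemma taylor2 p W :
  Rabs (v (eadd p W) - v p - sum4 (fun i => co i W * w i p) - quad (fun i j => h i j p) W / 2)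
  <= L2 * n1 W ^ 3.
Proof.
  set (x := fun t => eadd p (escal t W)).
  assert (HL0 : 0 <= L2) by (apply (HL2 0%nat 0%nat); lia).
  assert (X0 : x 0 = p) by (apply E_ext; unfold x; rewrite co_eadd, co_escal; ring).
  assert (X1 : x 1 = eadd p W) by (apply E_ext; unfold x; rewrite !co_eadd, co_escal; ring).
  rewrite <- X1, <- X0.
  apply (taylor1 (fun t => v (x t)) (fun t => sum4 (fun i => co i W * w i (x t)))
    (fun t => quad (fun i j => h i j (x t)) W)).
  - intros t. apply (is_derive_direction v w L1); auto.
  - intros t.
    assert (D : forall i, (i < 4)%nat -> is_derive (fun t => co i W * w i (x t)) t
      (co i W * sum4 (fun j => co j W * h i j (x t)))).
    { intros i Hi. apply is_derive_scal.
      apply (is_derive_direction (w i) (h i) L2); intros; auto. }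
    unfold quad, sum4 at 1 2.
    apply (is_derive_plus (K := R_AbsRing) (V := R_NormedModule)
      (fun t => co 0 W * w 0%nat (x t) + co 1 W * w 1%nat (x t) + co 2 W * w 2%nat (x t))
      (fun t => co 3 W * w 3%nat (x t))); [|apply D; lia].
    apply (is_derive_plus (K := R_AbsRing) (V := R_NormedModule)
      (fun t => co 0 W * w 0%nat (x t) + co 1 W * w 1%nat (x t))
      (fun t => co 2 W * w 2%nat (x t))); [|apply D; lia].
    apply (is_derive_plus (K := R_AbsRing) (V := R_NormedModule)
      (fun t => co 0 W * w 0%nat (x t)) (fun t => co 1 W * w 1%nat (x t))); apply D; lia.
  - intros t Ht.
    assert (Hh : forall i j, (i < 4)%nat -> (j < 4)%nat ->
      Rabs (co i W * (co j W * (h i j (x t) - h i j (x 0)))) <=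
      Rabs (co i W) * (Rabs (co j W) * (L2 * n1 W))).
    { intros i j Hi Hj. rewrite !Rabs_mult.
      apply Rmult_le_compat_l; [apply Rabs_pos|]. apply Rmult_le_compat_l; [apply Rabs_pos|].
      eapply Rle_trans; [apply (HL2 i j Hi Hj)|]. apply Rmult_le_compat_l; auto.
      rewrite X0. unfold x. rewrite dist1_eadd_l, n1_escal, Rabs_pos_eq by lra.
      pose proof (n1_pos W). nra. }
    assert (tri : forall a b A B, Rabs a <= A -> Rabs b <= B -> Rabs (a + b) <= A + B).
    { intros. eapply Rle_trans; [apply Rabs_triang|]. lra. }
    set (D := fun i j => co i W * (co j W * (h i j (x t) - h i j (x 0)))).
    set (Bd := fun i j => Rabs (co i W) * (Rabs (co j W) * (L2 * n1 W))).
    replace (quad (fun i j => h i j (x t)) W - quad (fun i j => h i j (x 0)) W)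
      with (sum4 (fun i => sum4 (fun j => D i j))) by (unfold quad, sum4, D; ring).
    replace (L2 * n1 W ^ 3) with (sum4 (fun i => sum4 (fun j => Bd i j)))
      by (unfold sum4, Bd, n1; ring).
    unfold sum4. repeat apply tri; apply Hh; lia.
Qed.

End Taylor2.

(** Over a full period the linear terms and the mixed term cancel. Only the sum of the two square
    coefficients survives, and this sum is what becomes the Levi form. *)
Lemma trig_integral c a b P Q Rr :
  RInt (fun th => c + (a * cos th + b * sin th) +
      (P * cos th ^ 2 + Q * (cos th * sin th) + Rr * sin th ^ 2)) 0 (2 * PI)
  = 2 * PI * c + PI * (P + Rr).
Proof.
  apply is_RInt_unique.
  set (f := fun th => c * th + (a * sin th - b * cos th) +
    (P * ((th + sin th * cos th) / 2) + Q * (sin th ^ 2 / 2) + Rr * ((th - sin th * cos th) / 2))).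
  replace (2 * PI * c + PI * (P + Rr)) with (f (2 * PI) - f 0).
  2: { unfold f. rewrite sin_2PI, cos_2PI, sin_0, cos_0. field. }
  apply (is_RInt_derive (V := R_CompleteNormedModule) f); unfold f.
  - intros x _. auto_derive; auto. pose proof (sin2_cos2 x) as H. unfold Rsqr in H.
    assert (H1 : sin x * sin x = 1 - cos x * cos x) by lra. simpl.
    replace (cos x * (cos x * 1)) with (cos x * cos x) by ring.
    replace (sin x * (sin x * 1)) with (sin x * sin x) by ring.
    field_simplify. simpl. replace (sin x * (sin x * 1)) with (sin x * sin x) by ring.
    rewrite H1. field.
  - intros x _.
    apply (ex_derive_continuous (K := R_AbsRing) (V := R_NormedModule)). auto_derive; auto.
Qed.

(** The sum in the conclusion is four times the Levi form along [b]. On the circle of radius [r] the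
    mean differs from [v q] by r^2/4 times this sum up to a cubic error, so a negative sum
    contradicts the inequality for small [r]. *)
Lemma submean_quad_nonneg v (w : nat -> R) (h : nat -> nat -> R) q eta L M b :
  Lip L v -> 0 < eta -> submean (fun x => x = q) eta v ->
  (forall W, Rabs (v (eadd q W) - v q - sum4 (fun i => co i W * w i) - quad h W / 2)
     <= M * n1 W ^ 3) ->
  0 <= quad h b + quad h (imul b).
Proof.
  intros Hv Heta Hsub HT.
  apply Rnot_lt_le. intros Hneg.
  set (S := quad h b + quad h (imul b)) in *.
  set (N := n1 b). assert (HN : 0 <= N) by apply n1_pos.
  set (M' := (Rabs M + 1) * (2 * N) ^ 3 + 1).
  assert (HM' : 1 <= M').
  { unfold M'. assert (0 <= (Rabs M + 1) * (2 * N) ^ 3); [|lra].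
    apply Rmult_le_pos; [pose proof (Rabs_pos M); lra|apply pow_le; lra]. }
  (* The first bound keeps the circle admissible; the second makes the cubic error at most half of
     the quadratic loss [- S / 4 * r ^ 2]. The added 1 allows [N = 0]. *)
  set (r := Rmin (eta / (N + 1)) (- S / (8 * M'))).
  assert (Hr : 0 < r).
  { apply Rmin_glb_lt; apply Rdiv_lt_0_compat; lra. }
  assert (Hr1 : r * N <= eta).
  { assert (H : r <= eta / (N + 1)) by apply Rmin_l.
    apply (Rmult_le_compat_r (N + 1)) in H; [|lra].
    replace (eta / (N + 1) * (N + 1)) with eta in H by (field; lra). lra. }
  assert (Hr2 : r * (8 * M') <= - S).
  { assert (H : r <= - S / (8 * M')) by apply Rmin_r.
    apply (Rmult_le_compat_r (8 * M')) in H; [|lra].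
    replace (- S / (8 * M') * (8 * M')) with (- S) in H by (field; lra). lra. }
  pose proof PI_RGT_0 as Hpi.
  assert (Hs := Hsub q (escal r b) eq_refl).
  rewrite n1_escal, Rabs_pos_eq in Hs by lra. fold N in Hs. specialize (Hs Hr1).
  set (A := r * sum4 (fun i => co i b * w i)).
  set (B := r * sum4 (fun i => co i (imul b) * w i)).
  set (P := r ^ 2 / 2 * quad h b).
  set (R' := r ^ 2 / 2 * quad h (imul b)).
  set (Q := r ^ 2 / 2 * (sum4 (fun i => co i b * sum4 (fun j => co j (imul b) * h i j)) +
     sum4 (fun i => co i (imul b) * sum4 (fun j => co j b * h i j)))).
  set (c := v q + M' * r ^ 3).
  assert (Hle : RInt (fun th => v (circ q (escal r b) th)) 0 (2 * PI) <=
    RInt (fun th => c + (A * cos th + B * sin th) +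
      (P * cos th ^ 2 + Q * (cos th * sin th) + R' * sin th ^ 2)) 0 (2 * PI)).
  { apply RInt_le; [lra| | |].
    - apply ex_RInt_cont. eapply Lip_circ_continuous, Hv.
    - apply ex_RInt_cont. intros x.
      apply (ex_derive_continuous (K := R_AbsRing) (V := R_NormedModule)). auto_derive; auto.
    - intros th _. unfold circ. specialize (HT (rot th (escal r b))).
      apply Rabs_le_between in HT. destruct HT as [_ HT].
      assert (HC : forall j, co j (rot th (escal r b)) = r * (cos th * co j b + sin th * co j (imul b))).
      { intros j. rewrite co_rot, co_escal. destruct j as [|[|[|j]]]; simpl; ring. }
      assert (HN3 : M * n1 (rot th (escal r b)) ^ 3 <= M' * r ^ 3).
      { pose proof (n1_rot th (escal r b)) as Hn. rewrite n1_escal, Rabs_pos_eq in Hn by lra.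
        fold N in Hn.
        assert (Hn3 : n1 (rot th (escal r b)) ^ 3 <= (2 * (r * N)) ^ 3).
        { apply pow_incr. split; [apply n1_pos|auto]. }
        assert (H0 : 0 <= n1 (rot th (escal r b)) ^ 3) by (apply pow_le, n1_pos).
        pose proof (Rle_abs M) as Hab. pose proof (Rabs_pos M) as Hab0.
        assert (H1 : M * n1 (rot th (escal r b)) ^ 3 <= (Rabs M + 1) * (2 * (r * N)) ^ 3).
        { apply Rle_trans with ((Rabs M + 1) * n1 (rot th (escal r b)) ^ 3).
          - apply Rmult_le_compat_r; lra.
          - apply Rmult_le_compat_l; lra. }
        eapply Rle_trans; [apply H1|]. unfold M'.
        assert (0 < r ^ 3) by (apply pow_lt; lra).
        replace ((Rabs M + 1) * (2 * (r * N)) ^ 3) with ((Rabs M + 1) * (2 * N) ^ 3 * r ^ 3) by ring.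
        lra. }
      replace (sum4 (fun i => co i (rot th (escal r b)) * w i)) with (A * cos th + B * sin th) in HT
        by (unfold sum4, A, B; rewrite !HC; unfold sum4; ring).
      replace (quad h (rot th (escal r b)) / 2) with
        (P * cos th ^ 2 + Q * (cos th * sin th) + R' * sin th ^ 2) in HT
        by (unfold quad, sum4, P, Q, R', quad, sum4; rewrite !HC; field).
      unfold c. lra. }
  rewrite trig_integral in Hle.
  assert (Hfin : v q <= / (2 * PI) * (2 * PI * c + PI * (P + R'))).
  { eapply Rle_trans; [apply Hs|]. apply Rmult_le_compat_l; [|exact Hle].
    left. apply Rinv_0_lt_compat. lra. }
  replace (/ (2 * PI) * (2 * PI * c + PI * (P + R'))) with (c + (P + R') / 2) in Hfin by (field; lra).
  replace (P + R') with (r ^ 2 / 2 * S) in Hfin by (unfold P, R', S; ring).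
  unfold c in Hfin.
  assert (H1 : 0 <= r ^ 2 * (M' * r + S / 4)) by (simpl in *; lra).
  assert (H2 : 0 < r ^ 2) by (apply pow_lt; lra).
  assert (H3 : M' * r + S / 4 < 0) by lra.
  nra.
Qed.

(** * Smooth strictly plurisubharmonic functions *)

Lemma Lip_le L L' u : L <= L' -> Lip L u -> Lip L' u.
Proof.
  intros HL [H0 H]. split; [lra|]. intros p q. eapply Rle_trans; [apply H|].
  apply Rmult_le_compat_r; [apply dist1_pos|exact HL].
Qed.

Lemma Lip_common (F : nat -> E -> R) :
  (forall i, exists L, Lip L (F i)) -> exists L, forall i, (i < 4)%nat -> Lip L (F i).
Proof.
  intros H.
  destruct (H 0%nat) as [L0 H0], (H 1%nat) as [L1 H1], (H 2%nat) as [L2 H2], (H 3%nat) as [L3 H3].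
  pose proof (proj1 H0). pose proof (proj1 H1). pose proof (proj1 H2). pose proof (proj1 H3).
  exists (L0 + L1 + L2 + L3). intros i Hi.
  destruct i as [|[|[|[|i]]]]; try lia; (eapply Lip_le; [|eassumption]); lra.
Qed.

Lemma co_Lip i : Lip 1 (co i).
Proof.
  split; [lra|]. intros p q. unfold dist1.
  pose proof (Rabs_pos (co 0 p - co 0 q)). pose proof (Rabs_pos (co 1 p - co 1 q)).
  pose proof (Rabs_pos (co 2 p - co 2 q)). pose proof (Rabs_pos (co 3 p - co 3 q)).
  destruct i as [|[|[|i]]]; try lra.
  change (co (S (S (S i)))) with (co 3). lra.
Qed.

Section Smoothing.

Variables (eps : R) (K : nat -> R -> R) (u : E -> R) (L : R).
Hypothesis Heps : 0 < eps < 1.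
Hypothesis HK : kernels eps K.
Hypothesis Hu : Lip L u.

Definition J0 : nat -> nat := fun _ => O.

Lemma V_close n p : Rabs (V K u n J0 p - u p) <= INR n * (L * eps).
Proof.
  revert p. induction n as [|n IH]; intros p.
  - simpl. rewrite Rminus_diag, Rabs_R0. lra.
  - destruct (V_Lip eps K Heps HK u L n J0 Hu) as [L' HL'].
    rewrite S_INR. replace ((INR n + 1) * (L * eps)) with (INR n * (L * eps) + L * eps) by ring.
    simpl V. eapply T_close; eauto; try apply HK. apply (K_continuous eps K HK).
Qed.

(** Every convolution costs a margin [eps] in the set of admissible centres, hence the radius
    [4 * eps] for all four axes. *)
Lemma V_submean q eta n : forall r,
  submean (fun x => dist1 x q <= r + INR n * eps) eta u ->
  submean (fun x => dist1 x q <= r) eta (V K u n J0).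
Proof.
  induction n as [|n IH]; intros r H.
  - simpl in *. intros a b Ha. apply H. lra.
  - simpl V.
    destruct (V_Lip eps K Heps HK u L n J0 Hu) as [L' HL'].
    destruct (K_bounded eps K Heps HK 0) as [B [_ HB]].
    destruct (K_lip eps K Heps HK 0) as [Lk [_ HLk]].
    apply (T_submean n (K 0%nat) _ (fun x => dist1 x q <= r + eps) _ eps eta B Lk L');
      auto; try apply HK.
    + intros a s Ha Hs. eapply Rle_trans; [apply (dist1_tri _ a)|]. rewrite dist1_sh_l. lra.
    + apply IH. intros a b Ha Hb. apply H; auto. rewrite S_INR. lra.
Qed.

Lemma V_invariant n J t p : (forall t p, u (sh 3 t p) = u p) -> V K u n J (sh 3 t p) = V K u n J p.
Proof.
  intros Hi. revert p. induction n as [|n IH]; intros p; [apply Hi|].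
  simpl. unfold T. apply RInt_ext. intros s _. now rewrite sh_comm, IH.
Qed.

Lemma V_Lip_family (F : nat -> nat -> nat) :
  exists L', forall i, (i < 4)%nat -> Lip L' (V K u 4 (F i)).
Proof. apply (Lip_common (fun i => V K u 4 (F i))). intros i. eapply V_Lip; eauto. Qed.

Lemma V_quad_nonneg q eta b :
  0 < eta -> submean (fun x => dist1 x q <= 4 * eps) eta u ->
  0 <= quad (fun i j => V K u 4 (incr j (incr i J0)) q) b +
       quad (fun i j => V K u 4 (incr j (incr i J0)) q) (imul b).
Proof.
  intros Heta Hsub.
  destruct (V_Lip eps K Heps HK u L 4 J0 Hu) as [L0 HL0].
  destruct (V_Lip_family (fun i => incr i J0)) as [L1 HL1].
  assert (HL2 : exists L2, forall i j, (i < 4)%nat -> (j < 4)%nat ->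
    Lip L2 (V K u 4 (incr j (incr i J0)))).
  { destruct (V_Lip_family (fun j => incr j (incr 0 J0))) as [A0 H0].
    destruct (V_Lip_family (fun j => incr j (incr 1 J0))) as [A1 H1].
    destruct (V_Lip_family (fun j => incr j (incr 2 J0))) as [A2 H2].
    destruct (V_Lip_family (fun j => incr j (incr 3 J0))) as [A3 H3].
    pose proof (proj1 (H0 0%nat ltac:(lia))). pose proof (proj1 (H1 0%nat ltac:(lia))).
    pose proof (proj1 (H2 0%nat ltac:(lia))). pose proof (proj1 (H3 0%nat ltac:(lia))).
    exists (A0 + A1 + A2 + A3). intros i j Hi Hj.
    destruct i as [|[|[|[|i]]]]; [| | | |lia].
    - apply (Lip_le A0); [lra|exact (H0 j Hj)].
    - apply (Lip_le A1); [lra|exact (H1 j Hj)].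
    - apply (Lip_le A2); [lra|exact (H2 j Hj)].
    - apply (Lip_le A3); [lra|exact (H3 j Hj)]. }
  destruct HL2 as [L2 HL2].
  apply (submean_quad_nonneg (V K u 4 J0) (fun i => V K u 4 (incr i J0) q) _ q eta L0 L2); auto.
  - intros a c -> Hc. apply (V_submean q eta 4 0); auto.
    + intros a' b' Ha'. apply Hsub. simpl INR in Ha'. lra.
    + rewrite dist1_refl. lra.
  - intros W. apply (taylor2 _ (fun i => V K u 4 (incr i J0))
      (fun i j => V K u 4 (incr j (incr i J0))) L1 L2); auto.
    + intros i p Hi. eapply V_derive; eauto.
    + intros i j p Hi Hj. eapply V_derive; eauto.
Qed.

(* A class of functions closed under partial derivatives: mollifications of [u] plus quadratic
   polynomials without mixed terms. *)
Definition Pf (J : nat -> nat) (A : R) (al be : nat -> R) (p : E) : R :=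
  V K u 4 J p + (A + sum4 (fun i => al i * co i p + be i * co i p ^ 2)).

Lemma Pf_derive J A al be i p : (i < 4)%nat ->
  is_derive (fun t => Pf J A al be (sh i t p)) 0
    (Pf (incr i J) (al i) (fun j => if Nat.eqb j i then 2 * be i else 0) (fun _ => 0) p).
Proof.
  intros Hi. unfold Pf.
  apply (is_derive_plus (K := R_AbsRing) (V := R_NormedModule) (fun t => V K u 4 J (sh i t p))).
  - eapply V_derive; eauto.
  - unfold sum4.
    apply (is_derive_ext (K := R_AbsRing) (V := R_NormedModule) (fun t =>
      A + (al 0%nat * (co 0 p + t * co 0 (basis i)) + be 0%nat * (co 0 p + t * co 0 (basis i)) ^ 2 +
       (al 1%nat * (co 1 p + t * co 1 (basis i)) + be 1%nat * (co 1 p + t * co 1 (basis i)) ^ 2) +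
       (al 2%nat * (co 2 p + t * co 2 (basis i)) + be 2%nat * (co 2 p + t * co 2 (basis i)) ^ 2) +
       (al 3%nat * (co 3 p + t * co 3 (basis i)) + be 3%nat * (co 3 p + t * co 3 (basis i)) ^ 2)))).
    + intros t. now rewrite !co_sh.
    + auto_derive; auto.
      destruct i as [|[|[|[|i]]]]; try lia; simpl; ring.
Qed.

Lemma pd_Pf J A al be i : (i < 4)%nat ->
  pd i (Pf J A al be) =
  Pf (incr i J) (al i) (fun j => if Nat.eqb j i then 2 * be i else 0) (fun _ => 0).
Proof.
  intros Hi. apply functional_extensionality. intros p.
  apply is_derive_unique. now apply Pf_derive.
Qed.

Lemma Pf_continuous J A al be p : continuous (Pf J A al be) p.
Proof.
  destruct (V_Lip eps K Heps HK u L 4 J Hu) as [L' HL'].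
  assert (Cc : forall i, continuous (co i) p) by (intros i; eapply Lip_continuous, co_Lip).
  set (t := fun i p => al i * co i p + be i * co i p ^ 2).
  assert (Ct : forall i, continuous (t i) p).
  { intros i. unfold t.
    apply (continuous_plus (V := R_NormedModule) (fun p => al i * co i p)).
    - apply (continuous_mult (K := R_AbsRing)); [apply continuous_const|apply Cc].
    - apply (continuous_mult (K := R_AbsRing) (fun _ => be i) (fun p => co i p ^ 2));
        [apply continuous_const|].
      apply (continuous_ext (fun p => co i p * co i p)); [intros; simpl; ring|].
      apply (continuous_mult (K := R_AbsRing)); apply Cc. }
  unfold Pf, sum4.
  apply (continuous_plus (V := R_NormedModule) (V K u 4 J)); [eapply Lip_continuous, HL'|].
  apply (continuous_plus (V := R_NormedModule) (fun _ => A)); [apply continuous_const|].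
  apply (continuous_plus (V := R_NormedModule) (fun p => t 0%nat p + t 1%nat p + t 2%nat p) (t 3%nat));
    [|apply Ct].
  apply (continuous_plus (V := R_NormedModule) (fun p => t 0%nat p + t 1%nat p) (t 2%nat));
    [|apply Ct].
  apply (continuous_plus (V := R_NormedModule) (t 0%nat) (t 1%nat)); apply Ct.
Qed.

Lemma Pf_smooth (U : E -> Prop) J A al be : smooth_on U (Pf J A al be).
Proof.
  intros k. revert J A al be. induction k as [|k IH]; intros J A al be.
  - split; auto. intros; apply Pf_continuous.
  - split; [intros; apply Pf_continuous|]. split.
    + intros i p Hi _. eexists. apply (Pf_derive J A al be i p Hi).
    + intros i Hi. rewrite pd_Pf by auto. apply IH.
Qed.

(** The linear part drops out and the quadratic part adds a constant. With coefficients 1, 1, 1, 0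
    this constant is |w1|^2 + |w2|^2 / 2, positive although nothing depends on Im z2. The two orders
    of a mixed derivative enter with equal weight, so they need not be identified. *)
Lemma Pf_levi A al be q w :
  Re (levi (Pf J0 A al be) q w) =
  (quad (fun i j => V K u 4 (incr j (incr i J0)) q) w +
   quad (fun i j => V K u 4 (incr j (incr i J0)) q) (imul w)) / 4 +
  ((be 0%nat + be 1%nat) * (co 0 w ^ 2 + co 1 w ^ 2) +
   (be 2%nat + be 3%nat) * (co 2 w ^ 2 + co 3 w ^ 2)) / 2.
Proof.
  unfold levi, dzdzb.
  simpl Nat.mul. simpl Nat.add.
  rewrite !pd_Pf by lia.
  unfold Pf. unfold sum4, quad, sum4. simpl Nat.eqb.
  destruct w as [[w0 w1] [w2 w3]]. simpl wcomp.
  generalize (V K u 4). intros W. cbn -[J0 incr Rplus Rmult Ropp Rminus Rdiv Rinv pow]. field.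
Qed.

End Smoothing.

(** * Polygonal components of sublevel sets *)

Lemma co_esub i p q : co i (esub p q) = co i p - co i q.
Proof. unfold esub. rewrite co_eadd, co_escal. ring. Qed.

Lemma n1_esub p q : n1 (esub p q) = dist1 p q.
Proof. unfold n1, dist1. now rewrite !co_esub. Qed.

Lemma enorm_co p : enorm p = sqrt (co 0 p ^ 2 + co 1 p ^ 2 + (co 2 p ^ 2 + co 3 p ^ 2)).
Proof.
  unfold enorm, Cmod. rewrite !pow2_sqrt; [reflexivity| |];
    apply Rplus_le_le_0_compat; apply pow2_ge_0.
Qed.

Lemma enorm_le_n1 p : enorm p <= n1 p.
Proof.
  rewrite enorm_co, <- (sqrt_pow2 (n1 p)) by apply n1_pos. apply sqrt_le_1_alt. unfold n1.
  rewrite <- (pow2_abs (co 0 p)), <- (pow2_abs (co 1 p)), <- (pow2_abs (co 2 p)), <- (pow2_abs (co 3 p)).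
  pose proof (Rabs_pos (co 0 p)). pose proof (Rabs_pos (co 1 p)).
  pose proof (Rabs_pos (co 2 p)). pose proof (Rabs_pos (co 3 p)). nra.
Qed.

Lemma n1_le_enorm p : n1 p <= 4 * enorm p.
Proof.
  assert (H : forall i, Rabs (co i p) <= enorm p).
  { intros i. rewrite enorm_co, <- sqrt_Rsqr_abs. apply sqrt_le_1_alt. rewrite Rsqr_pow2.
    pose proof (pow2_ge_0 (co 0 p)). pose proof (pow2_ge_0 (co 1 p)).
    pose proof (pow2_ge_0 (co 2 p)). pose proof (pow2_ge_0 (co 3 p)).
    destruct i as [|[|[|i]]]; [lra|lra|lra|].
    change (co (S (S (S i))) p) with (co 3 p). lra. }
  unfold n1. pose proof (H 0%nat). pose proof (H 1%nat). pose proof (H 2%nat). pose proof (H 3%nat). lra.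
Qed.

Lemma bdry_dist1 G p : bdry G p ->
  ~ G p /\ forall e, 0 < e -> exists z, G z /\ dist1 p z < e.
Proof.
  intros [H1 H2]. split; auto. intros e He.
  destruct (H2 (e / 4) ltac:(lra)) as [z [Hz Hd]]. exists z. split; auto.
  rewrite dist1_sym, <- n1_esub. pose proof (n1_le_enorm (esub z p)). lra.
Qed.

(** Let [m] be the supremum of the initial intervals on which [P] holds; local constancy at [m]
    carries [P] to [m] and, if [m < 1], beyond it. *)
Lemma unit_interval_clopen (P : R -> Prop) :
  (forall t, 0 <= t <= 1 -> exists e, 0 < e /\
     forall s, 0 <= s <= 1 -> Rabs (s - t) < e -> (P s <-> P t)) ->
  P 0 -> P 1.
Proof.
  intros Hloc H0.
  set (S := fun t => 0 <= t <= 1 /\ forall s, 0 <= s <= t -> P s).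
  assert (HS0 : S 0).
  { split; [lra|]. intros s Hs. replace s with 0 by lra. exact H0. }
  destruct (completeness S) as [m [Hub Hlub]].
  { exists 1. intros t [Ht _]. lra. }
  { now exists 0. }
  assert (Hm : 0 <= m <= 1).
  { split; [now apply Hub|]. apply Hlub. intros t [Ht _]. lra. }
  destruct (Hloc m Hm) as [e [He Hle]].
  assert (Hex : exists t, S t /\ m - e < t).
  { apply NNPP. intros Hn. assert (m <= m - e); [|lra].
    apply Hlub. intros t Ht. apply Rnot_lt_le. intros Hl. apply Hn. now exists t. }
  destruct Hex as [t [[Ht HPt] Hmt]].
  assert (Htm : t <= m) by (apply Hub; split; auto).
  assert (HPm : P m).
  { apply (Hle t); [lra| |apply HPt; lra]. apply Rabs_def1; lra. }
  assert (Hall : forall s, 0 <= s <= 1 -> s < m + e -> P s).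
  { intros s Hs Hse. destruct (Rle_dec s t) as [H|H]; [apply HPt; lra|].
    apply (Hle s); auto. apply Rabs_def1; lra. }
  destruct (Rlt_dec m 1) as [H|H]; [|apply Hall; lra].
  exfalso.
  assert (Hb : S (Rmin 1 (m + e / 2))).
  { pose proof (Rmin_l 1 (m + e / 2)). pose proof (Rmin_r 1 (m + e / 2)).
    split; [split; [apply Rmin_glb; lra|lra]|]. intros s Hs. apply Hall; lra. }
  apply Hub in Hb. revert Hb. unfold Rmin. destruct (Rle_dec 1 (m + e / 2)); lra.
Qed.

Definition seg (x y : E) (t : R) : E := eadd x (escal t (esub y x)).

Lemma co_seg i x y t : co i (seg x y t) = co i x + t * (co i y - co i x).
Proof. unfold seg. now rewrite co_eadd, co_escal, co_esub. Qed.

Lemma seg_0 x y : seg x y 0 = x.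
Proof. apply E_ext; rewrite co_seg; ring. Qed.

Lemma seg_1 x y : seg x y 1 = y.
Proof. apply E_ext; rewrite co_seg; ring. Qed.

Lemma dist1_seg_same x y s t : dist1 (seg x y s) (seg x y t) = Rabs (s - t) * dist1 y x.
Proof.
  unfold dist1. rewrite !co_seg.
  assert (H : forall i, Rabs (co i x + s * (co i y - co i x) - (co i x + t * (co i y - co i x)))
    = Rabs (s - t) * Rabs (co i y - co i x)).
  { intros i. rewrite <- Rabs_mult. f_equal. ring. }
  rewrite !H. ring.
Qed.

Lemma dist1_seg_convex c x y t e :
  0 <= t <= 1 -> dist1 c x < e -> dist1 c y < e -> dist1 c (seg x y t) < e.
Proof.
  intros Ht Hx Hy.
  assert (H : dist1 c (seg x y t) <= (1 - t) * dist1 c x + t * dist1 c y).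
  { assert (Hi : forall i, Rabs (co i c - co i (seg x y t)) <=
      (1 - t) * Rabs (co i c - co i x) + t * Rabs (co i c - co i y)).
    { intros i. rewrite co_seg.
      replace (co i c - (co i x + t * (co i y - co i x))) with
        ((1 - t) * (co i c - co i x) + t * (co i c - co i y)) by ring.
      eapply Rle_trans; [apply Rabs_triang|]. rewrite !Rabs_mult, (Rabs_pos_eq (1 - t)), (Rabs_pos_eq t) by lra. lra. }
    unfold dist1. pose proof (Hi 0%nat). pose proof (Hi 1%nat). pose proof (Hi 2%nat).
    pose proof (Hi 3%nat). lra. }
  destruct (Rlt_dec t 1); nra.
Qed.

(** The polygonal component of [z0]. For open [H] it is the connected component, but the chain of
    segments offers an induction and makes monotonicity in [H] immediate. *)
Inductive reach (H : E -> Prop) (z0 : E) : E -> Prop :=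
  | reach_refl : H z0 -> reach H z0 z0
  | reach_step x y : reach H z0 x -> (forall t, 0 <= t <= 1 -> H (seg x y t)) -> reach H z0 y.

Lemma reach_in H z0 z : reach H z0 z -> H z.
Proof.
  intros R. destruct R as [|x y _ Hs]; auto.
  rewrite <- (seg_1 x y). apply Hs. lra.
Qed.

Lemma reach_mono (H H' : E -> Prop) z0 z : (forall x, H x -> H' x) -> reach H z0 z -> reach H' z0 z.
Proof.
  intros Hi R. induction R as [|x y _ IH Hs]; [apply reach_refl; auto|].
  apply (reach_step _ _ x); auto.
Qed.

Lemma reach_convex_ball (H : E -> Prop) z0 c e x y :
  (forall q, dist1 c q < e -> H q) -> dist1 c x < e -> dist1 c y < e ->
  reach H z0 x -> reach H z0 y.
Proof.
  intros Hb Hx Hy R. apply (reach_step _ _ x); auto.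
  intros t Ht. apply Hb. now apply dist1_seg_convex.
Qed.

Lemma reach_open H z0 : open H -> open (reach H z0).
Proof.
  intros HO. apply open_dist1. intros p Hp.
  destruct (proj1 (open_dist1 H) HO p (reach_in _ _ _ Hp)) as [e [He Hb]].
  exists e. split; auto. intros q Hq. apply (reach_convex_ball H z0 p e p); auto.
  now rewrite dist1_refl.
Qed.

(** Of two separating open sets, the one containing [z0] captures each further segment of a chain,
    by connectedness of the unit interval, and hence everything. *)
Lemma reach_connected H z0 : connected_set (reach H z0).
Proof.
  assert (key : forall A B : E -> Prop, open A -> open B ->
    (forall z, reach H z0 z -> A z \/ B z) ->
    (forall z, reach H z0 z -> A z -> B z -> False) ->
    A z0 -> forall z, reach H z0 z -> A z).
  { intros A B HA HB Hcov Hdis H0 z R.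
    induction R as [|x y Rx IH Hs]; auto.
    (* Intermediate points of the segment are reached as well, so covering and disjointness may be
       used at each of them. *)
    assert (Rs : forall t, 0 <= t <= 1 -> reach H z0 (seg x y t)).
    { intros t Ht. apply (reach_step _ _ x); auto. intros s Hst.
      replace (seg x (seg x y t) s) with (seg x y (s * t))
        by (apply E_ext; rewrite !co_seg; ring).
      apply Hs. nra. }
    rewrite <- (seg_1 x y).
    apply (unit_interval_clopen (fun t => A (seg x y t))); [|now rewrite seg_0].
    intros t Ht.
    assert (Hloc : exists e, 0 < e /\ forall q, dist1 (seg x y t) q < e -> reach H z0 q ->
      (A q <-> A (seg x y t))).
    { destruct (Hcov _ (Rs t Ht)) as [Ha|Hb].
      - destruct (proj1 (open_dist1 A) HA _ Ha) as [e [He Hq]]. exists e. split; auto.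
        intros q Hqe _. split; auto.
      - destruct (proj1 (open_dist1 B) HB _ Hb) as [e [He Hq]]. exists e. split; auto.
        intros q Hqe Rq. split; intros Hc; exfalso.
        + apply (Hdis q); auto.
        + apply (Hdis (seg x y t)); auto. }
    destruct Hloc as [e [He Hq]].
    pose proof (dist1_pos y x) as Hd.
    exists (e / (dist1 y x + 1)). split; [apply Rdiv_lt_0_compat; lra|].
    intros s Hs' Hst. apply Hq; auto. rewrite dist1_seg_same, Rabs_minus_sym.
    apply (Rmult_lt_compat_r (dist1 y x + 1)) in Hst; [|lra].
    replace (e / (dist1 y x + 1) * (dist1 y x + 1)) with e in Hst by (field; lra).
    pose proof (Rabs_pos (s - t)). lra. }
  intros A B HA HB Hcov Hdis [a [Ra Ha]] [b [Rb Hb]].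
  assert (R0 : reach H z0 z0).
  { apply reach_refl. clear - Ra. induction Ra; auto. }
  destruct (Hcov z0 R0) as [H0|H0].
  - apply (Hdis b); auto. now apply (key A B).
  - apply (Hdis a); auto. apply (key B A); auto.
    + intros z Hz. destruct (Hcov z Hz); auto.
    + intros z Hz Hz1 Hz2. now apply (Hdis z).
Qed.

Lemma reach_domain H z0 : open H -> H z0 -> Defs.domain (reach H z0).
Proof.
  intros HO H0. split; [now apply reach_open|]. split; [|apply reach_connected].
  exists z0. now apply reach_refl.
Qed.

(** A segment in the Im z2 direction consists of translates of its starting point, so it stays in
    [H] and may prolong a chain. *)
Lemma reach_semitube H z0 :
  open H -> H z0 -> (forall t p, H p -> H (sh 3 t p)) -> semitube (reach H z0).
Proof.
  intros HO H0 Hi. split; [now apply reach_domain|].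
  assert (key : forall z1 x y y', reach H z0 (z1, (x, y)) -> reach H z0 (z1, (x, y'))).
  { intros z1 x y y' R. apply (reach_step _ _ (z1, (x, y))); auto.
    intros t _. replace (seg (z1, (x, y)) (z1, (x, y')) t) with (sh 3 (t * (y' - y)) (z1, (x, y))).
    - apply Hi. now apply (reach_in H z0).
    - apply E_ext; rewrite co_sh, co_seg; simpl; ring. }
  intros. split; apply key.
Qed.

Lemma Ck_mono (U U' : E -> Prop) k : (forall x, U' x -> U x) -> forall g, Ck k U g -> Ck k U' g.
Proof.
  intros Hi. induction k as [|k IH]; intros g [H1 H2]; split; auto.
  destruct H2 as [H2 H3]. split; auto.
Qed.

Section StronglyPseudoconvex.

Variables (f : E -> R) (z0 : E).
Hypothesis Hs : smooth_on (fun _ => True) f.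
Hypothesis Hgrad : forall q, f q = 0 -> gradient_nonzero f q.
Hypothesis Hlevi : forall q, f q = 0 -> forall w, w <> ((0, 0), (0, 0)) -> 0 < Re (levi f q w).

Lemma smooth_continuous p : continuous f p.
Proof. apply (Hs 0%nat). exact I. Qed.

Lemma smooth_pd i p : (i < 4)%nat -> is_derive (fun t => f (sh i t p)) 0 (pd i f p).
Proof.
  intros Hi. apply Derive_correct. destruct (Hs 1%nat) as [_ [H _]]. apply (H i p Hi I).
Qed.

Lemma smooth_pd_continuous i p : (i < 4)%nat -> continuous (pd i f) p.
Proof. intros Hi. destruct (Hs 1%nat) as [_ [_ H]]. apply (H i Hi). exact I. Qed.

Let H := fun z => f z < 0.

Lemma sublevel_open : open H.
Proof.
  apply open_dist1. intros p Hp. unfold H in *.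
  destruct (proj1 (continuous_dist1 f p) (smooth_continuous p) (- f p) ltac:(lra)) as [d [Hd Hq]].
  exists d. split; auto. intros q Hqd. specialize (Hq q Hqd). apply Rabs_def2 in Hq. lra.
Qed.

(** If [f p < 0], a small ball in the sublevel set joins [p] to a reached point nearby; if
    [f p > 0], no reached point is near. *)
Lemma reach_bdry_zero p : bdry (reach H z0) p -> f p = 0.
Proof.
  intros Hb. apply bdry_dist1 in Hb. destruct Hb as [Hn Hlim].
  destruct (Rtotal_order (f p) 0) as [Hp|[Hp|Hp]]; auto; exfalso.
  - apply Hn. destruct (proj1 (open_dist1 H) sublevel_open p Hp) as [e [He Hb]].
    destruct (Hlim e He) as [z [Rz Hz]].
    apply (reach_convex_ball H z0 p e z); auto. now rewrite dist1_refl.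
  - destruct (proj1 (continuous_dist1 f p) (smooth_continuous p) (f p) ltac:(lra)) as [d [Hd Hq]].
    destruct (Hlim d Hd) as [z [Rz Hz]]. specialize (Hq z Hz). apply Rabs_def2 in Hq.
    apply reach_in in Rz. unfold H in Rz. lra.
Qed.

Lemma descend i sg q h : (i < 4)%nat -> 0 < h ->
  (forall s, 0 <= s <= h -> sg * pd i f (sh i (sg * s) q) < 0) ->
  f (sh i (sg * h) q) < f q.
Proof.
  intros Hi Hh Hneg.
  assert (D : forall s, is_derive (fun s => f (sh i (sg * s) q)) s (sg * pd i f (sh i (sg * s) q))).
  { intros s. apply (is_derive_comp (K := R_AbsRing) (V := R_NormedModule)
      (fun t => f (sh i t q)) (fun s => sg * s)).
    - apply (is_derive_sh f (pd i f)). intros p. now apply smooth_pd.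
    - auto_derive; auto; ring. }
  destruct (MVT_gen (fun s => f (sh i (sg * s) q)) 0 h (fun s => sg * pd i f (sh i (sg * s) q)))
    as [c [Hc Ec]].
  - intros; apply D.
  - intros s _. apply continuity_pt_filterlim.
    apply (ex_derive_continuous (K := R_AbsRing) (V := R_NormedModule)). eexists; apply D.
  - rewrite Rmin_left, Rmax_right in Hc by lra. specialize (Hneg c Hc).
    simpl in Ec. rewrite Rmult_0_r, sh_0 in Ec. nra.
Qed.

(* Near a regular boundary point the sublevel set is connected: descend along a coordinate axis
   to a nearby level below 0, where the displaced neighbourhood lies in the sublevel set. *)
Lemma reach_locally_sublevel p : bdry (reach H z0) p ->
  exists e, 0 < e /\ forall q, dist1 p q < e -> (reach H z0 q <-> f q < 0).
Proof.
  intros Hb. pose proof (reach_bdry_zero p Hb) as Hp0.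
  destruct (Hgrad p Hp0) as [i [Hi Hne]].
  apply bdry_dist1 in Hb. destruct Hb as [_ Hlim].
  set (m := Rabs (pd i f p)).
  assert (Hm : 0 < m) by now apply Rabs_pos_lt.
  (* The sense along axis [i] in which [f] decreases near [p]. *)
  set (sg := if Rlt_dec 0 (pd i f p) then -1 else 1).
  assert (Hsg : sg * pd i f p = - m /\ Rabs sg = 1).
  { unfold sg, m. destruct (Rlt_dec 0 (pd i f p)).
    - rewrite (Rabs_pos_eq (pd i f p)) by lra. rewrite (Rabs_left (-1)) by lra. lra.
    - rewrite (Rabs_left (pd i f p)) by lra. rewrite Rabs_R1. lra. }
  destruct Hsg as [Hsg Hsg1].
  destruct (proj1 (continuous_dist1 _ p) (smooth_pd_continuous i p Hi) m Hm) as [r [Hr Hpd]].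
  assert (Hneg : forall q, dist1 p q < r -> sg * pd i f q < 0).
  { intros q Hq. specialize (Hpd q Hq).
    assert (Rabs (sg * (pd i f q - pd i f p)) < m) by (rewrite Rabs_mult, Hsg1; lra).
    apply Rabs_def2 in H0. lra. }
  assert (Hdist : forall q s, dist1 p q < r / 2 -> 0 <= s <= r / 2 -> dist1 p (sh i (sg * s) q) < r).
  { intros q s Hq Hsr. eapply Rle_lt_trans; [apply (dist1_tri _ q)|].
    rewrite (dist1_sym q), dist1_sh_l, Rabs_mult, Hsg1, Rabs_pos_eq by lra. lra. }
  assert (Hdesc : forall q s, dist1 p q < r / 2 -> 0 < s <= r / 2 -> f (sh i (sg * s) q) < f q).
  { intros q s Hq Hsr. apply descend; auto; [lra|]. intros t Ht. apply Hneg, Hdist; lra. }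
  set (h := r / 2) in *.
  assert (Hph : f (sh i (sg * h) p) < 0).
  { rewrite <- Hp0. apply Hdesc; [rewrite dist1_refl|]; unfold h; lra. }
  destruct (proj1 (open_dist1 H) sublevel_open _ Hph) as [e [He Hbot]].
  (* [e] keeps displaced points in a ball inside the sublevel set, [h] keeps the original ones where
     the descent is valid. *)
  exists (Rmin e h). split; [apply Rmin_glb_lt; unfold h; lra|].
  intros q Hq. split; [apply reach_in|]. intros Hfq.
  assert (Hto : forall x, dist1 p x < Rmin e h -> f x < 0 ->
    forall t, 0 <= t <= 1 -> f (seg x (sh i (sg * h) x) t) < 0).
  { intros x Hx Hfx t Ht.
    replace (seg x (sh i (sg * h) x) t) with (sh i (sg * (t * h)) x)
      by (apply E_ext; rewrite !co_seg, !co_sh; ring).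
    destruct (Rle_lt_dec t 0) as [Ht0|Ht0].
    - replace t with 0 by lra. now rewrite Rmult_0_l, Rmult_0_r, sh_0.
    - eapply Rlt_trans; [apply Hdesc|exact Hfx].
      + eapply Rlt_le_trans; [apply Hx|apply Rmin_r].
      + assert (0 < h) by (unfold h; lra). nra. }
  (* [z] is a reached point near [p]. The chain to [q] goes from [z] down by [h], across inside the
     ball about the displaced [p], and up again to [q]. *)
  destruct (Hlim (Rmin e h)) as [z [Rz Hz]]; [apply Rmin_glb_lt; unfold h; lra|].
  assert (Hsh : forall x, dist1 p x < Rmin e h -> dist1 (sh i (sg * h) p) (sh i (sg * h) x) < e).
  { intros x Hx. rewrite dist1_sh. eapply Rlt_le_trans; [apply Hx|apply Rmin_l]. }
  assert (R1 : reach H z0 (sh i (sg * h) z)).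
  { apply (reach_step _ _ z); auto. apply Hto; auto. apply (reach_in _ _ _ Rz). }
  assert (R2 : reach H z0 (sh i (sg * h) q)).
  { apply (reach_convex_ball H z0 (sh i (sg * h) p) e (sh i (sg * h) z)); auto. }
  apply (reach_step _ _ (sh i (sg * h) q)); auto.
  intros t Ht.
  replace (seg (sh i (sg * h) q) q t) with (seg q (sh i (sg * h) q) (1 - t))
    by (apply E_ext; rewrite !co_seg, !co_sh; ring).
  apply Hto; auto; lra.
Qed.

Lemma reach_strongly_pseudoconvex : strongly_pseudoconvex_smooth (reach H z0).
Proof.
  intros p Hp. destruct (reach_locally_sublevel p Hp) as [e [He HU]].
  exists (fun q => dist1 p q < e), f. split; [|split; [|split; [|split]]].
  - apply open_dist1. intros q Hq. exists (e - dist1 p q). split; [lra|].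
    intros x Hx. pose proof (dist1_tri p q x). lra.
  - now rewrite dist1_refl.
  - intros k. apply (Ck_mono (fun _ => True)); auto.
  - exact HU.
  - intros q Hq Hbq. pose proof (reach_bdry_zero q Hbq) as Hq0. split; auto.
Qed.

End StronglyPseudoconvex.

(** * Lipschitz images of cubes *)

(** The base R^3 is realised as the slice of [E] with last coordinate 0, so [dist1] and the
    Lipschitz lemmas apply unchanged. *)
Definition in_cube (R0 : R) (x : E) : Prop :=
  (forall i, (i < 3)%nat -> Rabs (co i x) <= R0) /\ co 3 x = 0.

(** Dividing by [2 * R0 + 1], not [2 * R0], makes the rescaled coordinate strictly smaller than [N]
    and allows [R0 = 0]. *)
Lemma grid_cell (R0 : R) (N : nat) : 0 <= R0 -> (0 < N)%nat -> forall t, Rabs t <= R0 ->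
  exists k, (k < N)%nat /\ INR k <= (t + R0) * (INR N / (2 * R0 + 1)) < INR k + 1.
Proof.
  intros HR HN t Ht. apply Rabs_le_between in Ht.
  assert (HN' : 0 < INR N) by now apply lt_0_INR.
  assert (H0 : 0 <= (t + R0) * (INR N / (2 * R0 + 1))).
  { apply Rmult_le_pos; [lra|]. apply Rdiv_le_0_compat; lra. }
  destruct (nfloor_ex _ H0) as [k Hk]. exists k. split; [|exact Hk].
  apply INR_lt. eapply Rle_lt_trans; [apply Hk|].
  apply (Rmult_lt_reg_r (2 * R0 + 1)); [lra|].
  replace ((t + R0) * (INR N / (2 * R0 + 1)) * (2 * R0 + 1)) with ((t + R0) * INR N) by (field; lra).
  nra.
Qed.

Lemma same_cell_close (R0 : R) (N k : nat) t t' : 0 <= R0 -> (0 < N)%nat ->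
  INR k <= (t + R0) * (INR N / (2 * R0 + 1)) < INR k + 1 ->
  INR k <= (t' + R0) * (INR N / (2 * R0 + 1)) < INR k + 1 ->
  Rabs (t - t') <= (2 * R0 + 1) / INR N.
Proof.
  intros HR HN H1 H2.
  assert (HN' : 0 < INR N) by now apply lt_0_INR.
  assert (Hq : 0 < INR N / (2 * R0 + 1)) by (apply Rdiv_lt_0_compat; lra).
  apply (Rmult_le_reg_r (INR N / (2 * R0 + 1))); [exact Hq|].
  replace ((2 * R0 + 1) / INR N * (INR N / (2 * R0 + 1))) with 1 by (field; split; lra).
  rewrite <- (Rabs_pos_eq (INR N / (2 * R0 + 1))) by lra. rewrite <- Rabs_mult.
  apply Rabs_le. lra.
Qed.

Lemma NoDup_list_prod {A B : Type} (l : list A) (l' : list B) :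
  NoDup l -> NoDup l' -> NoDup (list_prod l l').
Proof.
  intros Hl Hl'. induction Hl as [|a l Ha Hl IH]; simpl; [constructor|].
  apply NoDup_app; auto.
  - apply Injective_map_NoDup; auto. intros x y Hxy. now inversion Hxy.
  - intros [x y] Hin Hin'. apply in_map_iff in Hin. destruct Hin as [b [Hb _]].
    inversion Hb; subst. apply in_prod_iff in Hin'. tauto.
Qed.

(* A Lipschitz image of a 3-dimensional cube cannot contain a 4-dimensional one: N^3 cells
   cannot meet the m^4 points of a grid of mesh proportional to 1/N. *)
Lemma lipschitz_cube_misses (F : E -> E) (R0 Lam alpha : R) (l : E) :
  0 <= R0 -> 0 <= Lam -> 0 < alpha ->
  (forall x y j, in_cube R0 x -> in_cube R0 y -> (j < 4)%nat ->
     Rabs (co j (F x) - co j (F y)) <= Lam * dist1 x y) ->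
  exists y, (forall j, (j < 4)%nat -> co j l <= co j y <= co j l + alpha) /\
    forall x, in_cube R0 x -> F x <> y.
Proof.
  intros HR HLam Hal HF. apply NNPP. intros Hno.
  assert (Hhit : forall y, (forall j, (j < 4)%nat -> co j l <= co j y <= co j l + alpha) ->
    exists x, in_cube R0 x /\ F x = y).
  { intros y Hy. apply NNPP. intros Hn. apply Hno. exists y. split; auto.
    intros x Hx HFx. apply Hn. now exists x. }
  (* With [N = C * m], this choice of [C] makes the oscillation of [F] on one cell smaller than the
     mesh [alpha / m]. *)
  destruct (nfloor_ex (3 * Lam * (2 * R0 + 1) / alpha)) as [C0 [_ HC0]].
  { apply Rdiv_le_0_compat; [|lra]. apply Rmult_le_pos; lra. }
  set (C := S C0).
  assert (HC : 3 * Lam * (2 * R0 + 1) < alpha * INR C).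
  { unfold C. rewrite S_INR. apply (Rmult_lt_compat_l alpha) in HC0; [|lra].
    replace (alpha * (3 * Lam * (2 * R0 + 1) / alpha)) with (3 * Lam * (2 * R0 + 1)) in HC0
      by (field; lra). lra. }
  (* There are [m ^ 4] grid points and [N ^ 3 = C ^ 3 * m ^ 3] cells, so [m > C ^ 3] is what the
     count needs. *)
  set (m := S (C * C * C)). set (N := (C * m)%nat).
  assert (HmN : (0 < m)%nat /\ (0 < N)%nat /\ (0 < C)%nat) by (unfold N, m, C; nia).
  destruct HmN as [Hm [HN HCp]].
  assert (Hm' : 0 < INR m) by now apply lt_0_INR.
  assert (HC' : 0 < INR C) by now apply lt_0_INR.
  set (idx := ((nat * nat) * (nat * nat))%type).
  set (pt := fun i : idx => ((co 0 l + alpha / INR m * INR (fst (fst i)),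
                               co 1 l + alpha / INR m * INR (snd (fst i))),
                              (co 2 l + alpha / INR m * INR (fst (snd i)),
                               co 3 l + alpha / INR m * INR (snd (snd i)))) : E).
  set (good := fun i : idx => ((fst (fst i) < m)%nat /\ (snd (fst i) < m)%nat) /\
                              ((fst (snd i) < m)%nat /\ (snd (snd i) < m)%nat)).
  assert (Hcoord : forall c k, (k < m)%nat -> c <= c + alpha / INR m * INR k <= c + alpha).
  { intros c k Hk. apply lt_INR in Hk. pose proof (pos_INR k).
    assert (Hq : 0 < alpha / INR m) by (apply Rdiv_lt_0_compat; lra).
    assert (alpha / INR m * INR k <= alpha / INR m * INR m) by (apply Rmult_le_compat_l; lra).
    replace (alpha / INR m * INR m) with alpha in * by (field; lra). nra. }
  set (near := fun (t : R) (k : nat) =>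
    INR k <= (t + R0) * (INR N / (2 * R0 + 1)) < INR k + 1).
  (* Choice assigns to each grid point a preimage and the cell containing it; indices off the grid
     get a dummy value. *)
  assert (Hex : forall i : idx, exists xc : E * ((nat * nat) * nat), good i ->
    (in_cube R0 (fst xc) /\ F (fst xc) = pt i) /\
    (((fst (fst (snd xc)) < N)%nat /\ (snd (fst (snd xc)) < N)%nat) /\ (snd (snd xc) < N)%nat) /\
    (near (co 0 (fst xc)) (fst (fst (snd xc))) /\ near (co 1 (fst xc)) (snd (fst (snd xc))) /\
     near (co 2 (fst xc)) (snd (snd xc)))).
  { intros i. destruct (classic (good i)) as [Hg|Hg].
    2: { exists (((0, 0), (0, 0)), ((O, O), O)). tauto. }
    destruct (Hhit (pt i)) as [x [Hx HFx]].
    { intros j Hj. destruct Hg as [[G1 G2] [G3 G4]].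
      destruct j as [|[|[|[|j]]]]; try lia; simpl; apply Hcoord; auto. }
    destruct (grid_cell R0 N HR HN (co 0 x)) as [k0 [K0 N0]]; [apply Hx; lia|].
    destruct (grid_cell R0 N HR HN (co 1 x)) as [k1 [K1 N1]]; [apply Hx; lia|].
    destruct (grid_cell R0 N HR HN (co 2 x)) as [k2 [K2 N2]]; [apply Hx; lia|].
    exists (x, ((k0, k1), k2)). intros _.
    exact (conj (conj Hx HFx) (conj (conj (conj K0 K1) K2) (conj N0 (conj N1 N2)))). }
  apply functional_choice in Hex. destruct Hex as [g Hg].
  set (I := list_prod (list_prod (seq 0 m) (seq 0 m)) (list_prod (seq 0 m) (seq 0 m))).
  set (cells := list_prod (list_prod (seq 0 N) (seq 0 N)) (seq 0 N)).
  assert (HI : forall i, In i I -> good i).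
  { intros [[a b] [c d]] Hi. unfold I in Hi. rewrite !in_prod_iff, !in_seq in Hi.
    unfold good; simpl. lia. }
  (* Preimages in one cell have images closer than the mesh in every coordinate, so the two grid
     points coincide. *)
  assert (Hinj : forall i i', In i I -> In i' I -> snd (g i) = snd (g i') -> i = i').
  { intros i i' Hi Hi' Heq.
    destruct (Hg i (HI i Hi)) as [[Cx Fx] [_ [N0 [N1 N2]]]].
    destruct (Hg i' (HI i' Hi')) as [[Cx' Fx'] [_ [N0' [N1' N2']]]].
    rewrite <- Heq in N0', N1', N2'.
    assert (D0 := same_cell_close R0 N _ _ _ HR HN N0 N0').
    assert (D1 := same_cell_close R0 N _ _ _ HR HN N1 N1').
    assert (D2 := same_cell_close R0 N _ _ _ HR HN N2 N2').
    assert (Hd : dist1 (fst (g i)) (fst (g i')) <= 3 * ((2 * R0 + 1) / INR N)).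
    { unfold dist1. rewrite (proj2 Cx), (proj2 Cx'), Rminus_diag, Rabs_R0. lra. }
    assert (Hsmall : Lam * dist1 (fst (g i)) (fst (g i')) < alpha / INR m).
    { apply (Rle_lt_trans _ (Lam * (3 * ((2 * R0 + 1) / INR N)))).
      - apply Rmult_le_compat_l; auto.
      - unfold N. rewrite mult_INR.
        apply (Rmult_lt_reg_r (INR C * INR m)); [nra|].
        replace (Lam * (3 * ((2 * R0 + 1) / (INR C * INR m))) * (INR C * INR m))
          with (3 * Lam * (2 * R0 + 1)) by (field; split; lra).
        replace (alpha / INR m * (INR C * INR m)) with (alpha * INR C) by (field; lra). exact HC. }
    assert (Hc : forall c k k', Rabs ((c + alpha / INR m * INR k) - (c + alpha / INR m * INR k'))
        < alpha / INR m -> k = k').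
    { intros c k k' Hlt.
      assert (Hq : 0 < alpha / INR m) by (apply Rdiv_lt_0_compat; lra).
      replace (c + alpha / INR m * INR k - (c + alpha / INR m * INR k')) with
        (alpha / INR m * (INR k - INR k')) in Hlt by ring.
      rewrite Rabs_mult, (Rabs_pos_eq (alpha / INR m)) in Hlt by lra.
      assert (Hlt1 : Rabs (INR k - INR k') < 1) by nra.
      apply Rabs_def2 in Hlt1.
      destruct (Nat.lt_trichotomy k k') as [H|[H|H]]; auto;
        apply le_INR in H; rewrite S_INR in H; lra. }
    assert (HFj : forall j, (j < 4)%nat -> Rabs (co j (pt i) - co j (pt i')) < alpha / INR m).
    { intros j Hj. rewrite <- Fx, <- Fx'. eapply Rle_lt_trans; [apply HF; auto|exact Hsmall]. }
    destruct i as [[a b] [c d]], i' as [[a' b'] [c' d']].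
    pose proof (Hc _ _ _ (HFj 0%nat ltac:(lia))). pose proof (Hc _ _ _ (HFj 1%nat ltac:(lia))).
    pose proof (Hc _ _ _ (HFj 2%nat ltac:(lia))). pose proof (Hc _ _ _ (HFj 3%nat ltac:(lia))).
    simpl in *. congruence. }
  assert (Hlen : (length I <= length cells)%nat).
  { apply (Nat.le_trans _ (length (map (fun i => snd (g i)) I)));
      [apply Nat.eq_le_incl; symmetry; apply length_map|].
    apply NoDup_incl_length.
    - apply Injective_map_NoDup_in; [exact Hinj|].
      repeat apply NoDup_list_prod; apply seq_NoDup.
    - intros c Hc. apply in_map_iff in Hc. destruct Hc as [i [Hi HiI]].
      destruct (Hg i (HI i HiI)) as [_ [Hb _]]. rewrite Hi in Hb.
      destruct c as [[c0 c1] c2]. unfold cells. rewrite !in_prod_iff, !in_seq. simpl in *. lia. }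
  unfold I, cells in Hlen. rewrite !length_prod, !length_seq in Hlen.
  unfold N in Hlen.
  assert (Hpos : (0 < m * m * m)%nat) by nia.
  assert ((m * m * m) * m <= (m * m * m) * (C * C * C))%nat by nia.
  apply Nat.mul_le_mono_pos_l in H; auto. unfold m in H. lia.
Qed.

(** * Regular strongly pseudoconvex sublevel sets *)

(** The bound [M] is carried along because products of Lipschitz functions are Lipschitz only where
    the factors are bounded. *)
Definition LipOn (S : E -> Prop) (f : E -> R) : Prop :=
  exists L M, 0 <= L /\ 0 <= M /\ (forall x, S x -> Rabs (f x) <= M) /\
    forall x y, S x -> S y -> Rabs (f x - f y) <= L * dist1 x y.

Lemma LipOn_plus S f g : LipOn S f -> LipOn S g -> LipOn S (fun x => f x + g x).
Proof.
  intros [L [M [HL [HM [Hf1 Hf2]]]]] [L' [M' [HL' [HM' [Hg1 Hg2]]]]].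
  exists (L + L'), (M + M'). repeat split; try lra.
  - intros x Hx. eapply Rle_trans; [apply Rabs_triang|]. apply Rplus_le_compat; auto.
  - intros x y Hx Hy. replace (f x + g x - (f y + g y)) with ((f x - f y) + (g x - g y)) by ring.
    eapply Rle_trans; [apply Rabs_triang|]. rewrite Rmult_plus_distr_r.
    apply Rplus_le_compat; auto.
Qed.

Lemma LipOn_mult S f g : LipOn S f -> LipOn S g -> LipOn S (fun x => f x * g x).
Proof.
  intros [L [M [HL [HM [Hf1 Hf2]]]]] [L' [M' [HL' [HM' [Hg1 Hg2]]]]].
  exists (M * L' + M' * L), (M * M'). split; [nra|]. split; [nra|]. split.
  - intros x Hx. rewrite Rabs_mult. apply Rmult_le_compat; auto; apply Rabs_pos.
  - intros x y Hx Hy.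
    replace (f x * g x - f y * g y) with (f x * (g x - g y) + g y * (f x - f y)) by ring.
    eapply Rle_trans; [apply Rabs_triang|]. rewrite !Rabs_mult.
    assert (Rabs (f x) * Rabs (g x - g y) <= M * (L' * dist1 x y))
      by (apply Rmult_le_compat; auto; apply Rabs_pos).
    assert (Rabs (g y) * Rabs (f x - f y) <= M' * (L * dist1 x y))
      by (apply Rmult_le_compat; auto; apply Rabs_pos).
    lra.
Qed.

Lemma LipOn_const S c : LipOn S (fun _ => c).
Proof.
  exists 0, (Rabs c). split; [lra|]. split; [apply Rabs_pos|]. split; [intros; lra|].
  intros. rewrite Rminus_diag, Rabs_R0. lra.
Qed.

Lemma Lip_LipOn R0 L f : 0 <= R0 -> Lip L f -> LipOn (in_cube R0) f.
Proof.
  intros HR [HL H]. set (o := ((0, 0), (0, 0)) : E).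
  assert (H3 : 0 <= L * (3 * R0)) by (apply Rmult_le_pos; lra).
  exists L, (Rabs (f o) + L * (3 * R0)).
  split; [exact HL|]. split; [pose proof (Rabs_pos (f o)); lra|]. split; [|auto].
  intros x Hx. replace (f x) with (f o + (f x - f o)) by ring.
  eapply Rle_trans; [apply Rabs_triang|]. apply Rplus_le_compat_l.
  eapply Rle_trans; [apply H|]. apply Rmult_le_compat_l; auto.
  unfold dist1. rewrite (proj2 Hx). simpl (co _ o). rewrite !Rminus_0_r, Rabs_R0.
  pose proof (proj1 Hx 0%nat ltac:(lia)). pose proof (proj1 Hx 1%nat ltac:(lia)).
  pose proof (proj1 Hx 2%nat ltac:(lia)). lra.
Qed.

Lemma ln_lipschitz dl a b : 0 < dl -> dl <= a -> dl <= b -> Rabs (ln a - ln b) <= / dl * Rabs (a - b).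
Proof.
  assert (key : forall a b, 0 < dl -> dl <= b -> b <= a -> Rabs (ln a - ln b) <= / dl * Rabs (a - b)).
  { clear a b. intros a b Hd Hb Hab.
    assert (Hl : ln b <= ln a) by (apply ln_le; lra).
    rewrite !Rabs_pos_eq by lra.
    rewrite <- ln_div by lra.
    assert (Hq : 0 < a / b) by (apply Rdiv_lt_0_compat; lra).
    pose proof (exp_ineq1_le (ln (a / b))) as He. rewrite exp_ln in He by exact Hq.
    apply (Rle_trans _ ((a - b) * / b)).
    - replace ((a - b) * / b) with (a / b - 1) by (field; lra). lra.
    - rewrite Rmult_comm. apply Rmult_le_compat_r; [lra|]. apply Rinv_le_contravar; lra. }
  intros Hd Ha Hb. destruct (Rle_dec b a).
  - now apply key.
  - rewrite Rabs_minus_sym, (Rabs_minus_sym a). apply key; lra.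
Qed.

Lemma n1_cmul l b : Cmod l <= 1 -> n1 (cmul l b) <= 2 * n1 b.
Proof.
  intros Hl. pose proof (Rmax_Cmod l) as Hm.
  pose proof (Rmax_l (Rabs (fst l)) (Rabs (snd l))) as H1.
  pose proof (Rmax_r (Rabs (fst l)) (Rabs (snd l))) as H2.
  assert (H : forall j, Rabs (co j (cmul l b)) <= 1 * (Rabs (co j b) + Rabs (co j (imul b)))).
  { intros j. replace (co j (cmul l b)) with (fst l * co j b + snd l * co j (imul b))
      by (destruct j as [|[|[|j]]]; simpl; ring).
    apply lincomb_abs_le; lra. }
  pose proof (n1_imul b) as Hi. unfold n1 in *.
  pose proof (H 0%nat). pose proof (H 1%nat). pose proof (H 2%nat). pose proof (H 3%nat). lra.
Qed.

Definition sqn (p : E) : R := co 0 p ^ 2 + co 1 p ^ 2 + co 2 p ^ 2.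

Section Stage.

Variable d : E -> R.
Hypothesis Hd_lip : forall p q, Rabs (d p - d q) <= dist1 p q.
Hypothesis Hd_inv : forall t p, d (sh 3 t p) = d p.
Hypothesis Hd_psh : forall a b,
  (forall l : C, Cmod l <= 1 -> 0 < d (eadd a (cmul l b))) ->
  - ln (d a) <= / (2 * PI) * RInt (fun th => - ln (d (circ a b th))) 0 (2 * PI).

Definition trunc (dl : R) (p : E) : R := - ln (Rmax (d p) dl).

Lemma trunc_Lip dl : 0 < dl -> Lip (/ dl) (trunc dl).
Proof.
  intros Hdl. assert (Hi : 0 < / dl) by now apply Rinv_0_lt_compat.
  split; [lra|]. intros p q. unfold trunc.
  replace (- ln (Rmax (d p) dl) - - ln (Rmax (d q) dl)) with
    (ln (Rmax (d q) dl) - ln (Rmax (d p) dl)) by ring.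
  eapply Rle_trans; [apply (ln_lipschitz dl); auto; apply Rmax_r|].
  apply Rmult_le_compat_l; [lra|].
  eapply Rle_trans; [|apply Hd_lip].
  unfold Rmax, Rabs. destruct (Rle_dec (d q) dl), (Rle_dec (d p) dl);
    repeat destruct Rcase_abs; lra.
Qed.

Lemma trunc_inv dl t p : trunc dl (sh 3 t p) = trunc dl p.
Proof. unfold trunc. now rewrite Hd_inv. Qed.

Lemma trunc_eq dl p : dl <= d p -> trunc dl p = - ln (d p).
Proof. intros H. unfold trunc. now rewrite Rmax_left. Qed.

(** Centres lie within [gam / 2] of [q] and the discs reach at most [gam / 4] further, so [d]
    exceeds [dl] on them and the truncation is - ln d there. *)
Lemma trunc_submean dl gam eps q : 0 < dl -> 0 < gam -> 4 * eps <= gam / 2 -> dl + gam <= d q ->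
  submean (fun x => dist1 x q <= 4 * eps) (gam / 8) (trunc dl).
Proof.
  intros Hdl Hg He Hq a b Ha Hb. simpl in Ha.
  assert (HD : forall l, Cmod l <= 1 -> dl < d (eadd a (cmul l b))).
  { intros l Hl. pose proof (n1_cmul l b Hl) as Hn.
    pose proof (Hd_lip (eadd a (cmul l b)) q) as H.
    pose proof (dist1_tri (eadd a (cmul l b)) a q) as Ht. rewrite dist1_eadd_l in Ht.
    apply Rabs_le_between in H. lra. }
  assert (Hc : forall th, Cmod (cos th, sin th) <= 1).
  { intros th. unfold Cmod. simpl.
    apply (Rle_trans _ (sqrt 1)); [|rewrite sqrt_1; lra]. apply sqrt_le_1_alt.
    pose proof (sin2_cos2 th) as H. unfold Rsqr in H. lra. }
  rewrite trunc_eq.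
  2: { pose proof (Hd_lip a q) as H. apply Rabs_le_between in H. lra. }
  eapply Rle_trans; [apply (Hd_psh a b)|].
  - intros l Hl. specialize (HD l Hl). lra.
  - right. f_equal. apply RInt_ext. intros th _. symmetry. apply trunc_eq.
    left. apply (HD (cos th, sin th)). apply Hc.
Qed.

Definition base_quad (i : nat) : R := match i with O | 1%nat | 2%nat => 1 | _ => 0 end.

Lemma sqr_le_bound x s : x ^ 2 <= s -> Rabs x <= 1 + Rabs s.
Proof.
  intros H. pose proof (Rle_abs s). rewrite <- pow2_abs in H.
  pose proof (Rabs_pos x). nra.
Qed.

(** By invariance the last coordinate can be moved to 0, so [u] falls at most linearly in the other
    three while [sqn] grows quadratically. The subtracted absolute values leave room for a linear
    term with coefficients at most 1. *)
Lemma sublevel_bounded (u : E -> R) L (m : R) : Lip L u -> (forall t p, u (sh 3 t p) = u p) ->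
  exists R0, 1 <= R0 /\ forall p,
    u p + sqn p - (Rabs (co 0 p) + Rabs (co 1 p) + Rabs (co 2 p)) <= m ->
    forall i, (i < 3)%nat -> Rabs (co i p) <= R0.
Proof.
  intros [HL Hu] Hinv. set (o := ((0, 0), (0, 0)) : E).
  (* From x^2 - (L+1)|x| >= x^2/2 - (L+1)^2/2 in each of three coordinates, after doubling. *)
  set (s := 2 * (m - u o) + 3 * (L + 1) ^ 2).
  exists (1 + Rabs s). split; [pose proof (Rabs_pos s); lra|].
  intros p Hp.
  assert (H1 : u o - u p <= L * (Rabs (co 0 p) + Rabs (co 1 p) + Rabs (co 2 p))).
  { rewrite <- (Hinv (- co 3 p) p).
    eapply Rle_trans; [apply Rle_abs|]. eapply Rle_trans; [apply Hu|].
    apply Rmult_le_compat_l; auto. rewrite dist1_sym. unfold dist1. rewrite !co_sh. simpl.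
    rewrite !Rmult_0_r, !Rminus_0_r, !Rplus_0_r, Rmult_1_r, Rplus_opp_r, Rabs_R0. lra. }
  assert (Hsq : forall x, x ^ 2 / 2 - (L + 1) ^ 2 / 2 <= x ^ 2 - (L + 1) * Rabs x).
  { intros x. rewrite <- (pow2_abs x). pose proof (pow2_ge_0 (Rabs x - (L + 1))). nra. }
  assert (Hs : sqn p <= s).
  { unfold s, sqn in *. pose proof (Hsq (co 0 p)). pose proof (Hsq (co 1 p)).
    pose proof (Hsq (co 2 p)). lra. }
  unfold sqn in Hs.
  pose proof (pow2_ge_0 (co 0 p)). pose proof (pow2_ge_0 (co 1 p)). pose proof (pow2_ge_0 (co 2 p)).
  intros i Hi. destruct i as [|[|[|i]]]; try lia; apply sqr_le_bound; lra.
Qed.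

(* A critical point x of h + a.x at level c satisfies (a, c) = (- grad h x, h x - x . grad h x),
   which is a Lipschitz image of the 3-dimensional base; a generic (a, c) avoids it. *)
Lemma regular_perturbation eps K u L R0 alpha c0 :
  0 < eps < 1 -> kernels eps K -> Lip L u -> (forall t p, u (sh 3 t p) = u p) ->
  0 <= R0 -> 0 < alpha ->
  exists (al : nat -> R) (c : R),
    (forall i, 0 <= al i <= alpha) /\ al 3%nat = 0 /\ c0 <= c <= c0 + alpha /\
    forall q, (forall i, (i < 3)%nat -> Rabs (co i q) <= R0) ->
      Pf K u J0 (- c) al base_quad q = 0 -> gradient_nonzero (Pf K u J0 (- c) al base_quad) q.
Proof.
  intros Heps HK Hu Hinv HR Hal.
  set (g := fun i x => V K u 4 (incr i J0) x + 2 * co i x).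
  set (h := fun x => V K u 4 J0 x + (co 0 x * co 0 x + co 1 x * co 1 x + co 2 x * co 2 x)).
  set (F := fun x : E => ((- 1 * g 0%nat x, - 1 * g 1%nat x),
    (- 1 * g 2%nat x, h x + (-1) * (co 0 x * g 0%nat x + co 1 x * g 1%nat x + co 2 x * g 2%nat x))) : E).
  assert (HV : forall J, LipOn (in_cube R0) (V K u 4 J)).
  { intros J. destruct (V_Lip eps K Heps HK u L 4 J Hu) as [L' HL'].
    now apply (Lip_LipOn R0 L'). }
  assert (Hco : forall i, LipOn (in_cube R0) (co i)) by (intros i; apply (Lip_LipOn R0 1); auto; apply co_Lip).
  assert (Hg : forall i, LipOn (in_cube R0) (g i)).
  { intros i. apply LipOn_plus; auto. apply LipOn_mult; auto. apply LipOn_const. }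
  assert (HF : forall j, LipOn (in_cube R0) (fun x => co j (F x))).
  { assert (Hn : forall i, LipOn (in_cube R0) (fun x => -1 * g i x))
      by (intros i; apply LipOn_mult; auto; apply LipOn_const).
    destruct j as [|[|[|j]]]; try apply Hn.
    apply (LipOn_plus _ h (fun x =>
      (-1) * (co 0 x * g 0%nat x + co 1 x * g 1%nat x + co 2 x * g 2%nat x))).
    - unfold h. apply LipOn_plus; auto. repeat apply LipOn_plus; apply LipOn_mult; auto.
    - apply LipOn_mult; [apply LipOn_const|]. repeat apply LipOn_plus; apply LipOn_mult; auto. }
  destruct (HF 0%nat) as [L0 [_ [A0 [_ [_ B0]]]]]. destruct (HF 1%nat) as [L1 [_ [A1 [_ [_ B1]]]]].
  destruct (HF 2%nat) as [L2 [_ [A2 [_ [_ B2]]]]]. destruct (HF 3%nat) as [L3 [_ [A3 [_ [_ B3]]]]].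
  (* The first three coordinates of the missed point [y] become the linear coefficients, in
     [0, alpha], and the last one the level, in [c0, c0 + alpha]. *)
  destruct (lipschitz_cube_misses F R0 (L0 + L1 + L2 + L3) alpha ((0, 0), (0, c0)))
    as [y [Hy Hmiss]]; auto; [lra| |].
  { intros x x' j Hx Hx' Hj. pose proof (dist1_pos x x') as Hd.
    destruct j as [|[|[|[|j]]]]; try lia;
      [specialize (B0 x x' Hx Hx')|specialize (B1 x x' Hx Hx')|
       specialize (B2 x x' Hx Hx')|specialize (B3 x x' Hx Hx')]; nra. }
  exists (fun i => match i with O | 1%nat | 2%nat => co i y | _ => 0 end), (co 3 y).
  pose proof (Hy 0%nat ltac:(lia)) as Y0. pose proof (Hy 1%nat ltac:(lia)) as Y1.
  pose proof (Hy 2%nat ltac:(lia)) as Y2. pose proof (Hy 3%nat ltac:(lia)) as Y3.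
  simpl in Y0, Y1, Y2, Y3. split; [|split; [|split]]; auto.
  { intros i. destruct i as [|[|[|i]]]; simpl; lra. }
  set (al := fun i : nat => match i with O | 1%nat | 2%nat => co i y | _ => 0 end).
  intros q Hq Hq0. apply NNPP. intros Hcrit.
  assert (Hpd : forall i, (i < 4)%nat -> pd i (Pf K u J0 (- co 3 y) al base_quad) q = 0).
  { intros i Hi. apply NNPP. intros Hn. apply Hcrit. now exists i. }
  (* Invariance moves a critical point into the slice over which [F] was considered. *)
  set (x := sh 3 (- co 3 q) q).
  assert (Hx : forall i, (i < 3)%nat -> co i x = co i q).
  { intros i Hi. unfold x. rewrite co_sh. destruct i as [|[|[|i]]]; try lia; simpl; ring. }
  assert (Hx3 : co 3 x = 0) by (unfold x; rewrite co_sh; simpl; ring).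
  assert (HVx : forall J, V K u 4 J x = V K u 4 J q) by (intros; now apply V_invariant).
  assert (Hgx : forall i, (i < 3)%nat -> g i x = - al i).
  { intros i Hi. pose proof (Hpd i ltac:(lia)) as H.
    rewrite (pd_Pf eps K u L) in H by (auto; lia).
    unfold Pf in H. unfold g. rewrite HVx, (Hx i Hi).
    revert H. unfold sum4. destruct i as [|[|[|i]]]; try lia; simpl; lra. }
  apply (Hmiss x).
  - split; auto. intros i Hi. rewrite Hx; auto.
  - unfold Pf, sum4, al, base_quad in Hq0. cbv beta iota in Hq0.
    assert (G0 := Hgx 0%nat ltac:(lia)). assert (G1 := Hgx 1%nat ltac:(lia)).
    assert (G2 := Hgx 2%nat ltac:(lia)). unfold al in G0, G1, G2.
    apply E_ext.
    + change (-1 * g 0%nat x = co 0 y). rewrite G0. ring.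
    + change (-1 * g 1%nat x = co 1 y). rewrite G1. ring.
    + change (-1 * g 2%nat x = co 2 y). rewrite G2. ring.
    + change (h x + (-1) * (co 0 x * g 0%nat x + co 1 x * g 1%nat x + co 2 x * g 2%nat x) = co 3 y).
      rewrite G0, G1, G2. unfold h. rewrite HVx, !Hx by lia. lra.
Qed.

(** Smoothing and the linear term each cost at most 1/8, and [c] lies in [nu + 1/4, nu + 7/24]. So
    [f <= 0] gives [u + sqn <= nu + 13/24], below [nu + 3/4], while [u + sqn < nu] gives
    [f < nu + 1/4 - c <= 0]. *)
Lemma stage (nu : R) : exists f : E -> R,
  smooth_on (fun _ => True) f /\
  (forall t p, f (sh 3 t p) = f p) /\
  (forall q, f q = 0 -> gradient_nonzero f q) /\
  (forall q, f q = 0 -> forall w, w <> ((0, 0), (0, 0)) -> 0 < Re (levi f q w)) /\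
  (forall p, f p < 0 -> 0 < d p /\ - ln (d p) + sqn p < nu + 1) /\
  (forall p, 0 < d p -> - ln (d p) + sqn p < nu -> f p < 0).
Proof.
  (* Truncation starts at height [nu + 1], but the Levi form matters only below [nu + 3/4]; [gam] is
     the resulting margin in [d]. *)
  set (dl := exp (- (nu + 1))). set (gam := exp (- (nu + 3 / 4)) - dl).
  assert (Hdl : 0 < dl) by apply exp_pos.
  assert (Hgam : 0 < gam).
  { assert (dl < exp (- (nu + 3 / 4))) by (apply exp_increasing; lra). unfold gam. lra. }
  set (u := trunc dl). set (L := / dl).
  assert (Hu : Lip L u) by now apply trunc_Lip.
  assert (Huinv : forall t p, u (sh 3 t p) = u p) by (intros; apply trunc_inv).
  destruct (sublevel_bounded u L (nu + 1) Hu Huinv) as [R0 [HR0 Hbd]].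
  (* In turn: supports inside (-1, 1), four shifts within [gam / 2], and a total smoothing error
     [4 * (L * eps)] of at most 1/8. *)
  set (eps := Rmin (1 / 2) (Rmin (gam / 8) (dl / 32))).
  assert (Heps : 0 < eps < 1 /\ 4 * eps <= gam / 2 /\ 4 * (L * eps) <= 1 / 8).
  { assert (E1 : eps <= 1 / 2) by apply Rmin_l.
    assert (E2 : eps <= gam / 8) by (eapply Rle_trans; [apply Rmin_r|apply Rmin_l]).
    assert (E3 : eps <= dl / 32) by (eapply Rle_trans; [apply Rmin_r|apply Rmin_r]).
    assert (E0 : 0 < eps) by (repeat apply Rmin_glb_lt; lra).
    split; [lra|]. split; [lra|]. unfold L.
    apply (Rmult_le_compat_l (/ dl)) in E3; [|left; now apply Rinv_0_lt_compat].
    replace (/ dl * (dl / 32)) with (1 / 32) in E3 by (field; lra). lra. }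
  destruct Heps as [Heps [Heg HeL]].
  destruct (kernels_exist eps Heps) as [K HK].
  (* Three linear terms of size [alpha * R0] then sum to 1/8. *)
  set (alpha := / (24 * R0)).
  assert (Hal : 0 < alpha) by (apply Rinv_0_lt_compat; lra).
  assert (HaR : alpha * R0 = 1 / 24) by (unfold alpha; field; lra).
  assert (Hal1 : alpha <= 1 / 24) by nra.
  destruct (regular_perturbation eps K u L R0 alpha (nu + 1 / 4) Heps HK Hu Huinv)
    as [al [c [Hali [Hal3 [Hc Hreg]]]]]; [lra|lra|].
  set (f := Pf K u J0 (- c) al base_quad).
  assert (Hf : forall p, f p = V K u 4 J0 p + sqn p +
     (al 0%nat * co 0 p + al 1%nat * co 1 p + al 2%nat * co 2 p) - c).
  { intros p. unfold f, Pf, sum4, sqn, base_quad. rewrite Hal3. ring. }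
  assert (HV : forall p, - (1 / 8) <= V K u 4 J0 p - u p <= 1 / 8).
  { intros p. pose proof (V_close eps K u L Heps HK Hu 4 p) as H. simpl INR in H.
    apply Rabs_le_between in H. lra. }
  assert (Hlin : forall i p B, Rabs (co i p) <= B -> - (alpha * B) <= al i * co i p <= alpha * B).
  { intros i p B HB. apply Rabs_le_between. rewrite Rabs_mult, (Rabs_pos_eq (al i)) by apply Hali.
    apply Rmult_le_compat; auto; try apply Hali; apply Rabs_pos. }
  assert (Hlin1 : forall i p, - Rabs (co i p) <= al i * co i p).
  { intros i p. destruct (Hlin i p (Rabs (co i p)) (Rle_refl _)) as [H _].
    pose proof (Rabs_pos (co i p)). nra. }
  assert (Habs : forall p, 0 <= Rabs (co 0 p) + Rabs (co 1 p) + Rabs (co 2 p)).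
  { intros p. repeat apply Rplus_le_le_0_compat; apply Rabs_pos. }
  (* Two passes: the crude bound [Hlin1] on the linear term already confines [p] to the cube of
     radius [R0], and there the sharp bound 1/8 becomes available. *)
  assert (Hsub : forall p, f p <= 0 ->
    (forall i, (i < 3)%nat -> Rabs (co i p) <= R0) /\ u p + sqn p <= nu + 3 / 4).
  { intros p Hp. rewrite Hf in Hp. pose proof (HV p) as Hv.
    assert (HB : forall i, (i < 3)%nat -> Rabs (co i p) <= R0).
    { apply Hbd. pose proof (Hlin1 0%nat p). pose proof (Hlin1 1%nat p). pose proof (Hlin1 2%nat p). lra. }
    split; auto.
    pose proof (Hlin 0%nat p R0 (HB 0%nat ltac:(lia))). pose proof (Hlin 1%nat p R0 (HB 1%nat ltac:(lia))).
    pose proof (Hlin 2%nat p R0 (HB 2%nat ltac:(lia))). lra. }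
  assert (Hsqn : forall p, 0 <= sqn p).
  { intros p. unfold sqn. repeat apply Rplus_le_le_0_compat; apply pow2_ge_0. }
  (* Since [sqn] is nonnegative, the maximum of [d p] and [dl] is at least [dl + gam], so it is
     attained by [d p]. *)
  assert (Hdp : forall p, f p <= 0 -> dl + gam <= d p).
  { intros p Hp. destruct (Hsub p Hp) as [_ H]. pose proof (Hsqn p).
    unfold u, trunc in H.
    assert (Hmp : 0 < Rmax (d p) dl) by (eapply Rlt_le_trans; [apply Hdl|apply Rmax_r]).
    assert (He : exp (- (nu + 3 / 4)) <= Rmax (d p) dl).
    { rewrite <- (exp_ln _ Hmp). destruct (Req_dec (- (nu + 3 / 4)) (ln (Rmax (d p) dl))) as [->|Hne];
        [lra|]. left. apply exp_increasing. lra. }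
    unfold gam in *. revert He. unfold Rmax. destruct (Rle_dec (d p) dl); lra. }
  exists f. split; [|split; [|split; [|split; [|split]]]].
  - now apply (Pf_smooth eps K u L).
  - intros t p. rewrite !Hf. rewrite V_invariant by auto. unfold sqn. rewrite !co_sh. simpl. ring.
  - intros q Hq. apply Hreg; auto. apply Hsub. lra.
  - intros q Hq w Hw. unfold f. rewrite (Pf_levi eps K u L) by auto.
    pose proof (V_quad_nonneg eps K u L Heps HK Hu q (gam / 8) w ltac:(lra)
      (trunc_submean dl gam eps q Hdl Hgam Heg (Hdp q ltac:(lra)))) as HQ.
    simpl base_quad.
    assert (Hpos : 0 < co 0 w ^ 2 + co 1 w ^ 2 + (co 2 w ^ 2 + co 3 w ^ 2)).
    { pose proof (pow2_ge_0 (co 0 w)). pose proof (pow2_ge_0 (co 1 w)).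
      pose proof (pow2_ge_0 (co 2 w)). pose proof (pow2_ge_0 (co 3 w)).
      apply Rnot_le_lt. intros Hle. apply Hw.
      assert (Z : forall x, x ^ 2 <= 0 -> x = 0)
        by (intros x Hx; apply Rsqr_0_uniq; rewrite Rsqr_pow2; pose proof (pow2_ge_0 x); lra).
      apply E_ext; apply Z; lra. }
    pose proof (pow2_ge_0 (co 0 w)). pose proof (pow2_ge_0 (co 1 w)).
    pose proof (pow2_ge_0 (co 2 w)). pose proof (pow2_ge_0 (co 3 w)). lra.
  - intros p Hp. pose proof (Hdp p ltac:(lra)) as H. split; [lra|].
    rewrite <- (trunc_eq dl) by lra. fold u. destruct (Hsub p ltac:(lra)) as [_ H2]. lra.
  - intros p Hp Hphi.
    assert (Hld : dl <= d p).
    { rewrite <- (exp_ln _ Hp). left. apply exp_increasing. pose proof (Hsqn p). lra. }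
    rewrite <- (trunc_eq dl p Hld) in Hphi. fold u in Hphi.
    assert (HB : forall i, (i < 3)%nat -> Rabs (co i p) <= R0).
    { apply Hbd. pose proof (Habs p). lra. }
    rewrite Hf. pose proof (HV p).
    pose proof (Hlin 0%nat p R0 (HB 0%nat ltac:(lia))). pose proof (Hlin 1%nat p R0 (HB 1%nat ltac:(lia))).
    pose proof (Hlin 2%nat p R0 (HB 2%nat ltac:(lia))). lra.
Qed.

End Stage.

(** * Exhaustion *)

(** [enorm] is the modulus of the pair of moduli, so the triangle inequality for [Cmod] is used
    inside and then outside. *)
Lemma enorm_triangle p q : enorm (eadd p q) <= enorm p + enorm q.
Proof.
  assert (Hm : forall r : E, enorm r = Cmod (Cmod (fst r), Cmod (snd r))) by reflexivity.
  assert (mono : forall a b a' b', 0 <= a <= a' -> 0 <= b <= b' -> Cmod (a, b) <= Cmod (a', b')).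
  { intros a b a' b' Ha Hb. apply sqrt_le_1_alt. cbn [fst snd]. nra. }
  rewrite !Hm. eapply Rle_trans; [|apply Cmod_triangle].
  apply mono; (split; [apply Cmod_ge_0|apply Cmod_triangle]).
Qed.

(** The point outside [G] makes the greatest lower bound finite, so [real] does not fall back on its
    default 0. *)
Lemma bdist_spec G z : (exists w, ~ G w) ->
  (forall w, ~ G w -> bdist G z <= enorm (esub z w)) /\
  (forall b, (forall w, ~ G w -> b <= enorm (esub z w)) -> b <= bdist G z).
Proof.
  intros [w0 Hw0]. unfold bdist.
  set (S := fun r => exists w, ~ G w /\ r = enorm (esub z w)).
  destruct (Glb_Rbar_correct S) as [Hlb Hglb].
  assert (H0 : Rbar_le 0 (Glb_Rbar S)).
  { apply Hglb. intros r [w [_ ->]]. apply sqrt_pos. }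
  assert (H1 : Rbar_le (Glb_Rbar S) (enorm (esub z w0))) by (apply Hlb; now exists w0).
  destruct (Glb_Rbar S) as [g| |]; simpl in *; try contradiction.
  split.
  - intros w Hw. apply (Hlb (enorm (esub z w))). now exists w.
  - intros b Hb. apply (Hglb (Finite b)). intros r [w [Hw ->]]. now apply Hb.
Qed.

Lemma bdist_lip G : (exists w, ~ G w) -> forall p q, Rabs (bdist G p - bdist G q) <= dist1 p q.
Proof.
  intros Hex.
  assert (key : forall p q, bdist G p - bdist G q <= dist1 p q).
  { intros p q. destruct (bdist_spec G p Hex) as [Hp _]. destruct (bdist_spec G q Hex) as [_ Hq].
    assert (bdist G p - dist1 p q <= bdist G q); [|lra].
    apply Hq. intros w Hw. specialize (Hp w Hw).
    replace (esub p w) with (eadd (esub q w) (esub p q)) in Hp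
      by (apply E_ext; rewrite !co_eadd, !co_esub; ring).
    pose proof (enorm_triangle (esub q w) (esub p q)).
    pose proof (enorm_le_n1 (esub p q)) as Hn. rewrite n1_esub in Hn. lra. }
  intros p q. apply Rabs_le. pose proof (key p q). pose proof (key q p) as Hqp.
  rewrite dist1_sym in Hqp. lra.
Qed.

Lemma bdist_pos G : (exists w, ~ G w) -> open G -> forall z, 0 < bdist G z <-> G z.
Proof.
  intros Hex HO z. destruct (bdist_spec G z Hex) as [H1 H2]. split.
  - intros Hz. apply NNPP. intros Hn. specialize (H1 z Hn).
    assert (enorm (esub z z) <= 0); [|lra].
    eapply Rle_trans; [apply enorm_le_n1|]. rewrite n1_esub, dist1_refl. lra.
  - intros Hz. destruct (proj1 (open_dist1 G) HO z Hz) as [e [He Hb]].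
    assert (e / 4 <= bdist G z); [|lra].
    apply H2. intros w Hw. apply Rnot_lt_le. intros Hlt. apply Hw, Hb.
    rewrite <- n1_esub. pose proof (n1_le_enorm (esub z w)). lra.
Qed.

Lemma semitube_sh G : semitube G -> forall t p, G p -> G (sh 3 t p).
Proof.
  intros [_ H] t [z1 [x y]] Hp.
  assert (Eq : ((z1, (x, y + t)) : E) = sh 3 t (z1, (x, y)))
    by (apply E_ext; rewrite co_sh; simpl; ring).
  exact (eq_ind _ G (proj1 (H z1 x y (y + t)) Hp) _ Eq).
Qed.

Lemma bdist_inv G : (exists w, ~ G w) -> semitube G -> forall t p, bdist G (sh 3 t p) = bdist G p.
Proof.
  intros Hex HG.
  assert (key : forall t p, bdist G p <= bdist G (sh 3 t p)).
  { intros t p. destruct (bdist_spec G p Hex) as [Hp _].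
    apply (bdist_spec G (sh 3 t p) Hex). intros w Hw.
    replace (esub (sh 3 t p) w) with (esub p (sh 3 (- t) w))
      by (apply E_ext; rewrite !co_esub, !co_sh; ring).
    apply Hp. intros Hn. apply Hw. apply (semitube_sh G HG t) in Hn.
    rewrite sh_sh, Rplus_opp_r, sh_0 in Hn. exact Hn. }
  intros t p. apply Rle_antisym; [|apply key].
  rewrite <- (sh_0 3 p) at 2. rewrite <- (Rplus_opp_l t), <- sh_sh. apply key.
Qed.

(** If [G] is everything, the infimum is over the empty set and [bdist] takes the junk value 0; the
    constant 1 then serves as distance. Both cases thus meet one interface. *)
Lemma exhaustion_function G : semitube G -> pseudoconvex G -> exists d : E -> R,
  (forall p q, Rabs (d p - d q) <= dist1 p q) /\
  (forall t p, d (sh 3 t p) = d p) /\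
  (forall a b, (forall l : C, Cmod l <= 1 -> 0 < d (eadd a (cmul l b))) ->
    - ln (d a) <= / (2 * PI) * RInt (fun th => - ln (d (circ a b th))) 0 (2 * PI)) /\
  (forall z, 0 < d z <-> G z).
Proof.
  intros HS [_ HP]. destruct (classic (forall z, G z)) as [Hall|Hall].
  - exists (fun _ => 1). split; [|split; [|split]].
    + intros p q. rewrite Rminus_diag, Rabs_R0. apply dist1_pos.
    + reflexivity.
    + intros _ _ _. rewrite RInt_const_R, ln_1. lra.
    + intros z. split; [auto|lra].
  - destruct HP as [HP|[_ HP]]; [contradiction|].
    apply not_all_ex_not in Hall.
    pose proof (bdist_pos G Hall (proj1 (proj1 HS))) as Hpos.
    exists (bdist G). split; [|split; [|split]]; auto.
    + now apply bdist_lip.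
    + now apply bdist_inv.
    + intros a b Hb. apply HP. intros l Hl. apply Hpos. auto.
Qed.

(** Each point of [G] has a ball inside a single [H n]; a ball that meets the union of the
    components lies in it. So the union and its complement in [G] are both open, and connectedness
    decides. *)
Lemma nested_components_exhaust (G : E -> Prop) (H : nat -> E -> Prop) (z0 : E) :
  connected_set G -> G z0 ->
  (forall n, open (H n)) -> (forall n z, H n z -> H (S n) z) -> (forall n z, H n z -> G z) ->
  (forall z, G z -> exists n, H n z) -> H O z0 ->
  forall z, G z -> exists n, reach (H n) z0 z.
Proof.
  intros HG Hz0 HO Hmono Hsub Hcov H0 z Hz.
  assert (Hle : forall m n x, (m <= n)%nat -> H m x -> H n x).
  { intros m n x Hmn Hx. induction Hmn; auto. }
  set (A := fun z => exists n, reach (H n) z0 z).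
  assert (Hball : forall x, G x -> exists e, 0 < e /\
    forall p q, dist1 x p < e -> dist1 x q < e -> A p -> G q /\ A q).
  { intros x Hx. destruct (Hcov x Hx) as [n Hn].
    destruct (proj1 (open_dist1 _) (HO n) x Hn) as [e [He Hb]].
    exists e. split; auto. intros p q Hp Hq [m Rm]. split; [now apply (Hsub n), Hb|].
    (* A level large enough to contain both the ball and the chain to [p]. *)
    exists (max m n). apply (reach_convex_ball _ _ x e p); auto.
    - intros y Hy. apply (Hle n); [lia|auto].
    - apply (reach_mono (H m)); auto. intros y. apply Hle. lia. }
  apply NNPP. intros HnA.
  apply (HG A (fun x => G x /\ ~ A x)).
  - apply open_dist1. intros x Hx.
    assert (Gx : G x) by (destruct Hx as [n Rx]; apply (Hsub n), (reach_in _ _ _ Rx)).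
    destruct (Hball x Gx) as [e [He Hb]]. exists e. split; auto.
    intros q Hq. apply (Hb x q); auto. now rewrite dist1_refl.
  - apply open_dist1. intros x [Gx Hx].
    destruct (Hball x Gx) as [e [He Hb]].
    destruct (Hcov x Gx) as [n Hn].
    destruct (proj1 (open_dist1 _) (HO n) x Hn) as [e' [He' Hb']].
    exists (Rmin e e'). split; [now apply Rmin_glb_lt|].
    intros q Hq. split.
    + apply (Hsub n), Hb'. eapply Rlt_le_trans; [apply Hq|apply Rmin_r].
    + intros Aq. apply Hx. apply (Hb q x); auto; [|now rewrite dist1_refl].
      eapply Rlt_le_trans; [apply Hq|apply Rmin_l].
  - intros x Hx. destruct (classic (A x)); auto.
  - intros x _ Ax [_ Hn]. contradiction.
  - exists z0. split; auto. exists O. now apply reach_refl.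
  - exists z. auto.
Qed.

Theorem theorem1p2 (G : E -> Prop) :
  semitube G -> pseudoconvex G ->
  exists Gs : nat -> E -> Prop,
    (forall n, semitube (Gs n) /\ strongly_pseudoconvex_smooth (Gs n)) /\
    (forall n z, Gs n z -> Gs (S n) z) /\
    (forall n z, Gs n z -> G z) /\
    (forall z, G z <-> exists n, Gs n z).
Proof.
  intros HS HP.
  destruct (exhaustion_function G HS HP) as [d [Hlip [Hinv [Hpsh Hpos]]]].
  destruct (functional_choice _ (fun n : nat => stage d Hlip Hinv Hpsh (INR n))) as [f Hf].
  destruct (proj1 HS) as [_ [[z0 Hz0] Hconn]].
  set (phi := fun z => - ln (d z) + sqn z).
  assert (Hlarge : forall z, exists n, phi z < INR n).
  { intros z. destruct (INR_unbounded (phi z)) as [n Hn]. now exists n. }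
  (* Starting the sequence at [n0] puts the base point [z0] into every [H n], so all components are
     taken at the same point. *)
  destruct (Hlarge z0) as [n0 Hn0].
  set (H := fun n z => f (n + n0)%nat z < 0).
  assert (HO : forall n, open (H n)).
  { intros n. destruct (Hf (n + n0)%nat) as [Hs _]. now apply sublevel_open. }
  assert (Hmono : forall n z, H n z -> H (S n) z).
  { intros n z Hz. destruct (Hf (n + n0)%nat) as [_ [_ [_ [_ [H1 _]]]]].
    destruct (Hf (S n + n0)%nat) as [_ [_ [_ [_ [_ H2]]]]].
    destruct (H1 z Hz) as [Hd Hphi]. apply H2; auto.
    simpl Nat.add. now rewrite S_INR. }
  assert (Hsub : forall n z, H n z -> G z).
  { intros n z Hz. destruct (Hf (n + n0)%nat) as [_ [_ [_ [_ [H1 _]]]]].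
    apply Hpos. now apply H1. }
  assert (Hin : forall z n, G z -> phi z < INR (n + n0) -> H n z).
  { intros z n Hz Hn. destruct (Hf (n + n0)%nat) as [_ [_ [_ [_ [_ H2]]]]].
    apply H2; auto. now apply Hpos. }
  assert (H0 : forall n, H n z0).
  { intros n. apply Hin; auto. rewrite plus_INR. pose proof (pos_INR n). lra. }
  exists (fun n => reach (H n) z0). split; [|split; [|split]].
  - intros n. destruct (Hf (n + n0)%nat) as [Hs [Hi [Hg [Hl _]]]]. split.
    + apply reach_semitube; auto. intros t p Hp. unfold H. now rewrite Hi.
    + now apply reach_strongly_pseudoconvex.
  - intros n z. apply reach_mono. apply Hmono.
  - intros n z Rz. apply (Hsub n), (reach_in _ _ _ Rz).
  - intros z. split.
    + apply nested_components_exhaust; auto.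
      intros x Hx. destruct (Hlarge x) as [n Hn]. exists n. apply Hin; auto.
      rewrite plus_INR. pose proof (pos_INR n0). lra.
    + intros [n Rz]. apply (Hsub n), (reach_in _ _ _ Rz).
Qed.
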